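(* Let $(a_n)$ be a sequence of positive reals, let $P_N$ be the empirical joint distribution of the first three significant digits $(D_1,D_2,D_3)$ of $a_1,\dots,a_N$, let $P$ be the Benford joint distribution, and let $\Delta=P_N-P$. Let $p_{\min}=\min_{ijk}P(i,j,k)=4.35\times10^{-4}$. Then for all $N$ such that $\|\Delta\|_2<p_{\min}/2$, \[ |I_N-I_\infty| \le \|\nabla_\perp F(P)\|\cdot\|\Delta\|_2 + C_H\|\Delta\|_2^2, \] where $C_H=\tfrac12\|H_F(P)\|_{\mathrm{op}}\le 1{,}627$.
   Context: For $x>0$ write $x=m\cdot10^k$, $1\le m<10$; $D_k(x)=\lfloor10^{k-1}m\rfloor-10\lfloor10^{k-2}m\rfloor$ is the $k$-th significant digit. Digit triples $(i,j,k)$ range over $i\in\{1,\dots,9\}$, $j,k\in\{0,\dots,9\}$ (900 triples), with $\delta=100i+10j+k$. The Benford joint distribution is $P(i,j,k)=\log_{10}(1+1/\delta)$; the empirical distribution is $P_N(i,j,k)=\frac1N\#\{n\le N:(D_1(a_n),D_2(a_n),D_3(a_n))=(i,j,k)\}$. For a probability vector $Q$ on the 900 triples, $F(Q)$ is the conditional mutual information $I(D_1;D_3\mid D_2)$ (in bits) of $(D_1,D_2,D_3)\sim Q$; $I_N=F(P_N)$, $I_\infty=F(P)$. $\nabla F(P)$ and $H_F(P)$ are the gradient and Hessian of $F$ at $P$ in the 900 coordinates; $\nabla_\perp F(P)$ is the orthogonal projection of $\nabla F(P)$ onto the tangent space $\mathcal{T}=\{\delta:\sum_{ijk}\delta_{ijk}=0\}$,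 and $\|H_F(P)\|_{\mathrm{op}}$ is the operator norm of $H_F(P)$ restricted to $\mathcal{T}$. *)

(* Defs.v *)
From HB Require Import structures.
From mathcomp Require Import all_boot all_order all_algebra.
From mathcomp Require Import all_classical all_reals all_analysis.

Set Implicit Arguments.
Unset Strict Implicit.
Unset Printing Implicit Defensive.
Import Order.TTheory GRing.Theory Num.Theory.
Import numFieldNormedType.Exports.

Local Open Scope classical_set_scope.
Local Open Scope ring_scope.

Definition logb {R : realType} (b x : R) : R := ln x / ln b.

(** The [m] with [x = m * 10 ^ k], [1 <= m < 10]; see [significandP] and
    [significand_unique]. *)
Definition significand {R : realType} (x : R) : R :=
  get [set m | 1 <= m < 10 /\ exists k : int, x = m * 10 ^ k].

Definition digit {R : realType} (k : nat) (x : R) : int :=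
  Num.floor (10 ^ (k%:Z - 1) * significand x)
  - 10 * Num.floor (10 ^ (k%:Z - 2) * significand x).

(** The leading digit ranges over [1 .. 9], hence the shift in [dig1]. *)
Definition triple : finType := ('I_9 * 'I_10 * 'I_10)%type.
Definition dig1 (t : triple) : nat := (val t.1.1).+1.
Definition dig2 (t : triple) : nat := val t.1.2.
Definition dig3 (t : triple) : nat := val t.2.

Definition vec (R : realType) : Type := triple -> R.

Definition benford (R : realType) : vec R :=
  fun t => logb 10 (1 + 1 / (100 * dig1 t + 10 * dig2 t + dig3 t)%N%:R).

Definition empirical {R : realType} (a : nat -> R) (N : nat) : vec R :=
  fun t =>
    (count (fun n => [&& digit 1 (a n) == (dig1 t)%:Z,
                         digit 2 (a n) == (dig2 t)%:Z
                       & digit 3 (a n) == (dig3 t)%:Z]) (iota 1 N))%:R / N%:R.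

Definition marg12 {R : realType} (Q : vec R) (i : 'I_9) (j : 'I_10) : R :=
  \sum_(k : 'I_10) Q (i, j, k).
Definition marg23 {R : realType} (Q : vec R) (j k : 'I_10) : R :=
  \sum_(i : 'I_9) Q (i, j, k).
Definition marg2 {R : realType} (Q : vec R) (j : 'I_10) : R :=
  \sum_(i : 'I_9) \sum_(k : 'I_10) Q (i, j, k).

(** [I(D1; D3 | D2)] in bits.  Terms with [Q (i, j, k) = 0] vanish, as usual.
    The formula is used off the probability simplex too, which is what gives
    a meaning to its partial derivatives in the 900 coordinates. *)
Definition cond_mutual_info {R : realType} (Q : vec R) : R :=
  \sum_(i : 'I_9) \sum_(j : 'I_10) \sum_(k : 'I_10)
    Q (i, j, k)
    * logb 2 ((Q (i, j, k) * marg2 Q j) / (marg12 Q i j * marg23 Q j k)).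

Definition dotv {R : realType} (u v : vec R) : R := \sum_t u t * v t.
Definition norm2 {R : realType} (v : vec R) : R := Num.sqrt (\sum_t v t ^+ 2).

Definition basis_vec (R : realType) (t : triple) : vec R :=
  fun s => (s == t)%:R.

Definition partial {R : realType} (f : vec R -> R) (t : triple) (x : vec R)
    : R :=
  derive1 (fun h : R => f (fun s => x s + h * basis_vec R t s)) 0.

Definition gradient {R : realType} (f : vec R -> R) (x : vec R) : vec R :=
  fun t => partial f t x.

Definition hessian {R : realType} (f : vec R -> R) (x : vec R)
    (s t : triple) : R :=
  partial (partial f t) s x.

Definition tangent (R : realType) : set (vec R) :=
  [set v | \sum_t v t = 0].
Arguments tangent : clear implicits.

(** Orthogonal projection onto a linear subspace; see [orthoproj_tangentP]. *)
Definition orthoproj {R : realType} (V : set (vec R)) (v : vec R) : vec R :=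
  get [set w : triple -> R |
        V w /\ forall u, V u -> dotv (fun t => v t - w t) u = 0].

Definition mulmv {R : realType} (A : triple -> triple -> R) (v : vec R)
    : vec R :=
  fun s => \sum_t A s t * v t.

(** Operator norm, for the Euclidean norms, of [A] restricted to [V]. *)
Definition opnorm_on {R : realType} (V : set (vec R))
    (A : triple -> triple -> R) : R :=
  sup [set norm2 (mulmv A v) | v in [set v : vec R | V v /\ norm2 v <= 1]].

Definition p_min (R : realType) : R :=
  let t0 : triple := (ord0, ord0, ord0) in
  \big[Order.min/benford R t0]_(t : triple) benford R t.

Definition grad_perp_norm (R : realType) : R :=
  norm2 (orthoproj (tangent R) (gradient cond_mutual_info (benford R))).

Definition C_H (R : realType) : R :=
  1 / 2 * opnorm_on (tangent R) (hessian cond_mutual_info (benford R)).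

Lemma significandP (R : realType) (x : R) : 0 < x ->
  1 <= significand x < 10 /\ exists k : int, x = significand x * 10 ^ k.
Proof.
move=> x0; rewrite /significand.
case: xgetP => [m _ //|] /= nex; exfalso.
have l10 : 0 < ln (10 : R) by rewrite ln_gt0 // ltr1n.
pose k := Num.floor (ln x / ln (10 : R)).
have t0 (z : int) : 0 < (10 : R) ^ z by rewrite exprz_gt0.
have lnk (z : int) : ln ((10 : R) ^ z) = z%:~R * ln 10.
  case: z => n; first by rewrite -exprnP lnXn // mulr_natl.
  rewrite NegzE -invr_expz lnV ?posrE // -exprnP lnXn //.
  by rewrite mulrNz mulNr mulr_natl.
apply: (nex (x / 10 ^ k)); split; last by exists k; rewrite divfK ?gt_eqF.
apply/andP; split.
  rewrite ler_pdivlMr // mul1r -ler_ln ?posrE // lnk -ler_pdivlMr //.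
  exact: Num.Theory.floor_le.
rewrite ltr_pdivrMr // -{1}(expr1z 10) -expfzDr ?pnatr_eq0 //.
rewrite -ltr_ln ?posrE // lnk -ltr_pdivrMr // addrC.
exact: Num.Theory.floorD1_gt.
Qed.

Lemma significand_unique (R : realType) (m m' : R) (k l : int) :
  1 <= m < 10 -> 1 <= m' < 10 -> m * 10 ^ k = m' * 10 ^ l -> m = m'.
Proof.
wlog kl : m m' k l / k <= l => [hw hm hm' e|].
  by case: (leP k l) => [|/ltW] h; [apply: (hw _ _ k l)|
    apply/esym/(hw _ _ l k)].
move=> /andP[m1 m10] /andP[m1' m10'] e.
have k0 : (10 : R) ^ k != 0 by rewrite gt_eqF // exprz_gt0.
have {}e : m = m' * 10 ^ (l - k).
  apply: (mulIf k0); rewrite -mulrA -expfzDr ?pnatr_eq0 //.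
  by rewrite subrK e.
move: kl; rewrite -subr_ge0; move: e; case: (l - k) => [[|n]|n] // e _.
  by rewrite e expr0z mulr1.
move: m10; rewrite e -exprnP exprS mulrCA ltNge => /negP[].
by rewrite ler_peMr // mulr_ege1 // exprn_ege1 // ler1n.
Qed.

Lemma orthoproj_tangentP (R : realType) (v : vec R) :
  orthoproj (tangent R) v = (fun t => v t - (\sum_s v s) / #|triple|%:R).
Proof.
have c0 : (#|triple|%:R : R) != 0.
  by rewrite pnatr_eq0 -lt0n; apply/card_gt0P; exists (ord0, ord0, ord0).
set w := fun t => _.
have tw : tangent R w.
  rewrite /tangent /= /w sumrB sumr_const -[X in _ - X]mulr_natr divfK //.
  by rewrite subrr.
apply: xget_unique => [|w' [tw' hw']].
  split=> // u tu; rewrite /dotv /w.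
  under eq_bigr do rewrite opprB addrC subrK.
  by rewrite -mulr_sumr tu mulr0.
have : \sum_t (w t - w' t) ^+ 2 = 0.
  have td : tangent R (fun t => w t - w' t).
    by rewrite /tangent /= sumrB tw tw' subrr.
  rewrite -[RHS](hw' _ td) /dotv.
  transitivity (\sum_t ((v t - w' t) * (w t - w' t)
                        - (\sum_s v s) / #|triple|%:R * (w t - w' t))).
    by apply: eq_bigr => t _; rewrite -mulrBl addrAC expr2.
  by rewrite sumrB -mulr_sumr td mulr0 subr0.
move=> /eqP; rewrite psumr_eq0; last by move=> t _; exact: sqr_ge0.
move=> /allP h; apply/funext => t.
have := h t (mem_index_enum _); rewrite /= sqrf_eq0 subr_eq0 => /eqP.
by move=> ->.
Qed.

(* Main.v *)
(** Write [F] for the conditional mutual information, [X x = x ln x] and [D] for the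
    perturbation.  Since [F ln 2] is the alternating sum of [X] over the four
    coarse-grainings (123), (2), (12), (23), one has exactly
      [F (P + D) - F P = grad F . D + (KL_123 + KL_2 - KL_12 - KL_23) / ln 2].
    - Hessian norm: by the Cauchy-Schwarz inequality the (2)-part of the Hessian is
      dominated by the (12)-part, and the rest splits into 100 problems "diagonal
      minus rank one" of size 9; the one at (j, k) = (9, 9) is the tightest.
      Testing on [e_999 - e_998] gives [C_H >= 1573].
    - Lower bound: monotonicity of relative entropy leaves [- KL_23], and
      [KL_23 / ln 2 <= 1573 |D|^2].
    - Upper bound: only [KL_123] is kept, and it exceeds [C_H |D|^2] when [D] sits on
      cells of small probability.  The excess is absorbed by [|grad F| |D|], because
      there [D] is far from parallel to the gradient: a cellwise AM-GM inequality
      reduces this to the positivity of a weighted sum of squares of the gradient,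
      which is checked by interval arithmetic over the 900 cells. *)

Require Import Defs.
From HB Require Import structures.
From Stdlib Require Import ZArith.
From mathcomp Require Import all_boot all_order all_algebra.
From mathcomp Require Import all_classical all_reals all_analysis.
From mathcomp Require Import ring lra zify ssrZ.

Set Implicit Arguments.
Unset Strict Implicit.
Unset Printing Implicit Defensive.
Import Order.TTheory GRing.Theory Num.Theory.
Import numFieldNormedType.Exports.

Local Open Scope ring_scope.

Delimit Scope Z_scope with BZ.

(** The right-hand side carries the true [C_H], so bounding it from above does not help there: both
    halves of the estimate run through [C_H >= 1573]. The obstacle is the upper half. A perturbation
    of size near [p_min / 2] can almost halve the probability of cell 999; the divergence then costs
    nearly [5/8] instead of [1/2] times [D^2 / p], in bits about [2075 D^2], beyond 1627. Even the
    plain second-order coefficient of that cell is about 1660, because the (23)-part is no longer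
    subtracted. So no estimate of the quadratic term alone suffices. The linear term has room: it
    reaches [|grad F| |D|] only for [D] parallel to the projected gradient, and the weighted sum of
    squares says that such a [D] puts enough of its mass on cells whose coefficient is below [C_H].
    The lower half is easier: a (23)-marginal pools nine cells, so even a bound for its divergence
    that lacks the factor [1/2] stays under 1573. *)

Section DerivativeRules.
Context {R : realType}.
Implicit Types a b x y z p q : R.

(* A copy of [is_derive] that is not a class, so that applying the rules below
   does not trigger instance search. *)
Definition has_deriv (f : R -> R) (x d : R) : Prop := is_derive x 1 f d.

Section DeriveRules.
Variables (f g : R -> R) (x a b : R).
Hypotheses (fa : has_deriv f x a) (gb : has_deriv g x b).

Lemma has_derivD : has_deriv (fun y => f y + g y) x (a + b).
Proof. exact: (@is_deriveD _ _ _ _ _ _ _ _ _ fa gb). Qed.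

Lemma has_derivN : has_deriv (fun y => - f y) x (- a).
Proof. exact: (@is_deriveN _ _ _ _ _ _ _ fa). Qed.

Lemma has_derivM : has_deriv (fun y => f y * g y) x (f x * b + g x * a).
Proof. exact: (@is_deriveM _ _ _ _ _ _ _ _ fa gb). Qed.

Lemma has_derivV : f x != 0 -> has_deriv (fun y => (f y)^-1) x (- a / f x ^+ 2).
Proof.
move=> fx0; have := is_deriveV fx0 fa.
by rewrite /GRing.scale/= mulNr mulrC -mulNr.
Qed.

Lemma has_deriv_ln : 0 < f x -> has_deriv (fun y => ln (f y)) x (a / f x).
Proof.
move=> fx0; have h := is_derive1_ln fx0.
by have := @is_derive1_comp _ _ _ _ _ _ h fa; rewrite mulrC.
Qed.

Lemma has_deriv_eq c : a = c -> has_deriv f x c.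
Proof. by move=> <-. Qed.

End DeriveRules.

Lemma has_deriv_id x : has_deriv (fun y => y) x 1.
Proof. exact: is_derive_id. Qed.

Lemma has_deriv_cst c x : has_deriv (fun=> c) x 0.
Proof. exact: is_derive_cst. Qed.

Lemma has_derivX2 (f : R -> R) x a : has_deriv f x a ->
  has_deriv (fun y => f y ^+ 2) x (2 * f x * a).
Proof.
move=> fa; have -> : (fun y => f y ^+ 2) = (fun y => f y * f y).
  by apply/funext => y; rewrite expr2.
by have := has_derivM fa fa; rewrite -mulrDl -mulr2n mulr_natl.
Qed.

Lemma near_eq_has_deriv (f g : R -> R) x d :
  (\forall y \near x, f y = g y) -> has_deriv f x d -> has_deriv g x d.
Proof. exact: near_eq_is_derive. Qed.

End DerivativeRules.

Ltac has_deriv_tac := repeat first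
  [ apply: has_deriv_id | apply: has_deriv_cst | apply: has_derivX2
  | apply: has_derivD | apply: has_derivN | apply: has_deriv_ln
  | apply: has_derivV | apply: has_derivM ].

(** * Rational bounds for the logarithm *)

Section LogBounds.
Context {R : realType}.
Implicit Types a b x y z p q : R.

Lemma le_of_derive_ge0 (f df : R -> R) a b : a <= b ->
  (forall x, a <= x <= b -> has_deriv f x (df x)) ->
  (forall x, a <= x <= b -> 0 <= df x) -> f a <= f b.
Proof.
move=> ab fdf df0.
have [||c cab fE] := @MVT_segment R f df a b ab.
- by move=> x /[!in_itv]/= /andP[ax xb]; apply: fdf; rewrite !ltW.
- apply: derivable_within_continuous => x /[!in_itv]/= xab.
  exact: (ex_derive (is_derive := fdf x xab)).
rewrite -subr_ge0 fE mulr_ge0 ?subr_ge0//.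
by apply: df0; move: cab; rewrite in_itv.
Qed.

(** The series [2 artanh z = 2 (z + z^3/3 + z^5/5 + ...)], cut after the cubic term. *)
Lemma ln_ratio_lower z : 0 <= z < 1 ->
  2 * z * (1 + z ^+ 2 / 3) <= ln (1 + z) - ln (1 - z).
Proof.
move=> /andP[z0 z1].
pose f x := ln (1 + x) - ln (1 - x) - 2 * x * (1 + x ^+ 2 / 3).
pose df x := 2 * x ^+ 4 / ((1 + x) * (1 - x)).
suff : f 0 <= f z by rewrite /f addr0 subr0 ln1 mulr0 mul0r; lra.
apply: (@le_of_derive_ge0 f df _ _ z0) => x /andP[x0 xz].
  have xp : 0 < 1 + x by lra.
  have xm : 0 < 1 - x by lra.
  apply: has_deriv_eq; first by rewrite /f; has_deriv_tac.
  rewrite /df.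
  by field; rewrite !gt_eqF.
by rewrite /df divr_ge0 ?mulr_ge0 ?exprn_ge0//; lra.
Qed.

(** In the same series the coefficients [1/5, 1/7, ...] are raised to [1/3], which leaves a
    geometric series in [z^2]. *)
Lemma ln_ratio_upper z : 0 <= z < 1 ->
  ln (1 + z) - ln (1 - z) <= 2 * z * (1 + z ^+ 2 / (3 * (1 - z ^+ 2))).
Proof.
move=> /andP[z0 z1].
pose f x := 2 * x * (1 + x ^+ 2 / (3 * (1 - x ^+ 2))) - (ln (1 + x) - ln (1 - x)).
pose df x := 4 * x ^+ 4 / (3 * ((1 + x) * (1 - x)) ^+ 2).
suff : f 0 <= f z by rewrite /f addr0 subr0 ln1 mulr0 mul0r; lra.
apply: (@le_of_derive_ge0 f df _ _ z0) => x /andP[x0 xz].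
  have xp : 0 < 1 + x by lra.
  have xm : 0 < 1 - x by lra.
  have x2 : 3 * (1 - x ^+ 2) != 0.
    rewrite gt_eqF// mulr_gt0// (_ : 1 - x ^+ 2 = (1 + x) * (1 - x)); last by ring.
    by rewrite mulr_gt0.
  apply: has_deriv_eq; first by rewrite /f; has_deriv_tac.
  rewrite /df.
  field; rewrite !gt_eqF//= (_ : 1 - x ^+ 2 = (1 + x) * (1 - x)); last by ring.
  by rewrite mulr_gt0.
by rewrite /df divr_ge0 ?mulr_ge0 ?exprn_ge0//; lra.
Qed.

(** The right-hand side is the [2/1] Pade approximant at 0, exact to third order. The derivative of
    the difference has the sign of [y^3], so the difference is smallest at 0. *)
Lemma ln1D_pade x : -1 < x -> ln (1 + x) <= x * (6 + x) / (6 + 4 * x).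
Proof.
move=> x1.
pose f y := y * (6 + y) / (6 + 4 * y) - ln (1 + y).
pose df y := 4 * y ^+ 3 / ((1 + y) * (6 + 4 * y) ^+ 2).
have fdf y : -1 < y -> has_deriv f y (df y).
  move=> y1; have y1p : 0 < 1 + y by lra.
  have y4 : 6 + 4 * y != 0 by rewrite gt_eqF//; lra.
  apply: has_deriv_eq; first by rewrite /f; has_deriv_tac.
  rewrite /df.
  by field; rewrite y4 gt_eqF.
have f0 : f 0 = 0 by rewrite /f !(addr0, mulr0) ln1 !mul0r subrr.
suff : 0 <= f x by rewrite /f subr_ge0.
have [x0|x0] := leP 0 x.
  rewrite -f0; apply: (@le_of_derive_ge0 f df _ _ x0) => y /andP[y0 yx].
    by apply: fdf; lra.
  by rewrite /df divr_ge0 ?mulr_ge0 ?exprn_ge0//; lra.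
have := @le_of_derive_ge0 (fun y => - f y) (fun y => - df y) x 0 (ltW x0).
rewrite f0 oppr0 oppr_le0; apply=> y /andP[xy y0].
  have y1 : -1 < y by lra.
  exact: has_derivN (fdf y y1).
have y3 : y ^+ 3 <= 0 by rewrite exprS mulr_le0_ge0 ?sqr_ge0.
rewrite /df oppr_ge0 pmulr_lle0 ?invr_gt0; first lra.
by rewrite mulr_gt0 ?exprn_gt0//; lra.
Qed.

(** With [z = (a - b) / (a + b)] the logarithm is [ln (a / b)]. It is odd in [z], so there is no
    quadratic error, and the cubic one is about [2/3 * 10^-6] at the end of the range. *)
Lemma ln_ratio_approx z : `|z| <= 1 / 100 ->
  `|ln ((1 + z) / (1 - z)) - 2 * z| <= 1 / 10 ^+ 6.
Proof.
wlog z0 : z / 0 <= z => [hw|].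
  move=> hz; have [/hw|z0] := leP 0 z; first exact.
  have := hw (- z); rewrite oppr_ge0 normrN => /(_ (ltW z0) hz).
  move: hz; rewrite ler_norml => /andP[z1 _].
  rewrite opprK -normrN ler_norml => h; rewrite -invf_div lnV ?posrE; last first.
    by rewrite divr_gt0//; lra.
  by rewrite ler_norml; lra.
rewrite ger0_norm// => z1; rewrite ln_div ?posrE; [|lra|lra].
have zz : 0 <= z < 1 by lra.
have := ln_ratio_lower zz; have := ln_ratio_upper zz.
have z2 : z ^+ 2 <= 1 / 10 ^+ 4.
  have -> : 1 / 10 ^+ 4 = (1 / 100) ^+ 2 :> R by field.
  by rewrite ler_sqr ?nnegrE//; lra.
have z20 := sqr_ge0 z.
have h : z ^+ 2 / (3 * (1 - z ^+ 2)) <= 1 / (2 * 10 ^+ 4).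
  by rewrite ler_pdivrMr; lra.
rewrite ler_norml => u l; apply/andP; split; nra.
Qed.
End LogBounds.

(** * Marginals as pushforwards *)

Section Pushforward.
Context {R : realType} {T U : finType}.
Implicit Types (f : T -> U) (v w : T -> R).

(** One notion covers the joint law and its three marginals ([f] is [id], [pi2], [pi12] or [pi23]),
    so each fact on coarse-graining is proved once. *)
Definition pushv f v (u : U) : R := \sum_(t | f t == u) v t.

Lemma pushv_gt0 f v t : (forall s, 0 < v s) -> 0 < pushv f v (f t).
Proof.
move=> v0; rewrite /pushv (bigD1 t)//= ltr_wpDr//.
by apply: sumr_ge0 => s _; exact: ltW.
Qed.

Lemma pushv_ge0 f v u : (forall s, 0 <= v s) -> 0 <= pushv f v u.
Proof. by move=> v0; exact: sumr_ge0. Qed.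

Lemma sum_pushvM f v (c : U -> R) :
  \sum_u pushv f v u * c u = \sum_t v t * c (f t).
Proof.
rewrite (partition_big f xpredT)//=; apply: eq_bigr => u _.
by rewrite mulr_suml; apply: eq_bigr => t /eqP ->.
Qed.

Lemma sum_pushv f v : \sum_u pushv f v u = \sum_t v t.
Proof.
have := sum_pushvM f v (fun=> 1); under eq_bigr do rewrite mulr1.
by move=> ->; under eq_bigr do rewrite mulr1.
Qed.

End Pushforward.

(** * Gradient and Hessian of conditional mutual information *)

Section Entropy.
Context {R : realType}.
Implicit Types (x y v w Q : vec R) (t s : triple).

Definition xlnx (z : R) := z * ln z.

Lemma sum_triple (f : triple -> R) :
  \sum_t f t = \sum_i \sum_j \sum_k f (i, j, k).
Proof. by rewrite !pair_bigA/=; apply: eq_bigr => -[[i j] k]. Qed.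

Definition pi2 (t : triple) : 'I_10 := t.1.2.
Definition pi12 (t : triple) : 'I_9 * 'I_10 := t.1.
Definition pi23 (t : triple) : 'I_10 * 'I_10 := (t.1.2, t.2).

Lemma pushv_id v t : pushv id v t = v t.
Proof. by rewrite /pushv big_pred1_eq. Qed.

Lemma marg2E v j : marg2 v j = pushv pi2 v j.
Proof.
rewrite /pushv big_mkcond/= sum_triple; apply: eq_bigr => i _.
rewrite [RHS](bigD1 j)//= [X in _ = _ + X]big1 ?addr0 => [|l /negbTE lj].
  by apply: eq_bigr => k _; rewrite /pi2/= eqxx.
by rewrite big1// => k _; rewrite /pi2/= lj.
Qed.

Lemma marg12E v i j : marg12 v i j = pushv pi12 v (i, j).
Proof.
rewrite /pushv big_mkcond/= sum_triple.
rewrite [RHS](bigD1 i)//= [X in _ = _ + X]big1 ?addr0 => [|l /negbTE li].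
  rewrite [RHS](bigD1 j)//= [X in _ = _ + X]big1 ?addr0 => [|l /negbTE lj].
    by apply: eq_bigr => k _; rewrite /pi12/= eqxx.
  by rewrite big1// => k _; rewrite /pi12/= xpair_eqE lj andbF.
by rewrite big1// => j' _; rewrite big1// => k _; rewrite /pi12/= xpair_eqE li.
Qed.

Lemma marg23E v j k : marg23 v j k = pushv pi23 v (j, k).
Proof.
rewrite /pushv big_mkcond/= sum_triple; apply: eq_bigr => i _.
rewrite [RHS](bigD1 j)//= [X in _ = _ + X]big1 ?addr0 => [|l /negbTE lj].
  rewrite [RHS](bigD1 k)//= [X in _ = _ + X]big1 ?addr0 => [|l /negbTE lk].
    by rewrite /pi23/= eqxx.
  by rewrite /pi23/= xpair_eqE lk andbF.
by rewrite big1// => k' _; rewrite /pi23/= xpair_eqE lj.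
Qed.

(* The alternating sum over the four coarse-grainings that make up
   [I(D1; D3 | D2) = - H(D1,D2,D3) - H(D2) + H(D1,D2) + H(D2,D3)]. *)
Definition alt4 (c : forall U : finType, (triple -> U) -> R) : R :=
  c triple id + c _ pi2 - c _ pi12 - c _ pi23.

(** Each entropy term has derivative [ln + 1]; the four constants 1 cancel in the alternating
    sum. *)
Definition grad_cmi x t : R := alt4 (fun U f => ln (pushv f x (f t))) / ln 2.

(** Euler's identity: the formula for [F] is homogeneous of degree 1. *)
Lemma cmi_grad Q : (forall t, 0 < Q t) ->
  cond_mutual_info Q = \sum_t Q t * grad_cmi Q t.
Proof.
move=> Q0; rewrite sum_triple /cond_mutual_info.
apply: eq_bigr => i _; apply: eq_bigr => j _; apply: eq_bigr => k _.
rewrite /logb /grad_cmi /alt4 marg2E marg12E marg23E pushv_id.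
have p2 : 0 < pushv pi2 Q j := pushv_gt0 pi2 (i, j, k) Q0.
have p12 : 0 < pushv pi12 Q (i, j) := pushv_gt0 pi12 (i, j, k) Q0.
have p23 : 0 < pushv pi23 Q (j, k) := pushv_gt0 pi23 (i, j, k) Q0.
rewrite ln_div ?posrE ?mulr_gt0// lnM ?posrE// lnM ?posrE//.
by rewrite opprD addrA.
Qed.

Definition ent (U : finType) (f : triple -> U) Q : R :=
  \sum_u xlnx (pushv f Q u).

Lemma entE (U : finType) (f : triple -> U) Q :
  ent f Q = \sum_t Q t * ln (pushv f Q (f t)).
Proof. by rewrite /ent /xlnx -(sum_pushvM f Q (fun u => ln (pushv f Q u))). Qed.

Lemma cmi_ent Q : (forall t, 0 < Q t) ->
  cond_mutual_info Q = alt4 (fun U f => ent f Q) / ln 2.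
Proof.
move=> Q0; rewrite cmi_grad// /grad_cmi /alt4 !entE -big_split/=.
by rewrite -!sumrB mulr_suml; apply: eq_bigr => t _; ring.
Qed.

Lemma pushv_shift (U : finType) (f : triple -> U) x t h u :
  pushv f (fun s => x s + h * basis_vec R t s) u
  = pushv f x u + h * (f t == u)%:R.
Proof.
rewrite /pushv big_split/= -mulr_sumr; congr (_ + h * _).
rewrite /basis_vec big_mkcond/= (bigD1 t)//= eqxx big1 ?addr0.
  by case: ifP.
by move=> s /negbTE ->; rewrite if_same.
Qed.

Lemma shift_gt0_near x t : (forall s, 0 < x s) ->
  \forall h \near (0 : R), forall s, 0 < x s + h * basis_vec R t s.
Proof.
move=> x0; near=> h => s; rewrite /basis_vec.
have [->|] := eqVneq s t; last by rewrite mulr0 addr0.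
rewrite mulr1 -ltrBlDl sub0r; near: h; apply: lt_nbhsr.
by rewrite oppr_lt0.
Unshelve. all: by end_near. Qed.

Lemma has_deriv_ent (U : finType) (f : triple -> U) x t :
  (forall s, 0 < x s) ->
  has_deriv (fun h => ent f (fun s => x s + h * basis_vec R t s)) 0
    (ln (pushv f x (f t)) + 1).
Proof.
move=> x0; have p0 := pushv_gt0 f t x0.
have -> : (fun h => ent f (fun s => x s + h * basis_vec R t s))
  = fun h => (pushv f x (f t) + h) * ln (pushv f x (f t) + h)
             + \sum_(u | u != f t) xlnx (pushv f x u).
  apply/funext => h; rewrite /ent (bigD1 (f t))//=; congr (_ + _).
    by rewrite pushv_shift eqxx mulr1.
  by apply: eq_bigr => u /negbTE uf; rewrite pushv_shift eq_sym uf mulr0 addr0.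
have p00 : 0 < pushv f x (f t) + 0 by rewrite addr0.
apply: has_deriv_eq; first by has_deriv_tac.
rewrite !addr0; field; rewrite gt_eqF//.
Qed.

Lemma ln2_gt0 : 0 < ln (2 : R). Proof. by rewrite ln_gt0// ltr1n. Qed.

Lemma has_deriv_cmi x t : (forall s, 0 < x s) ->
  has_deriv (fun h => cond_mutual_info (fun s => x s + h * basis_vec R t s)) 0
    (grad_cmi x t).
Proof.
move=> x0.
(* [cmi_ent] needs positive entries, and the shifted vector has them only for small [h]. *)
apply: (@near_eq_has_deriv _
  (fun h => alt4 (fun U f => ent f (fun s => x s + h * basis_vec R t s)) / ln 2)).
  by near=> h; rewrite cmi_ent//; near: h; exact: shift_gt0_near.
have d1 := has_deriv_ent id t x0; have d2 := has_deriv_ent pi2 t x0.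
have d3 := has_deriv_ent pi12 t x0; have d4 := has_deriv_ent pi23 t x0.
have d := has_derivM (has_derivD (has_derivD (has_derivD d1 d2)
  (has_derivN d3)) (has_derivN d4)) (has_deriv_cst (ln 2)^-1 0).
apply: (has_deriv_eq d).
by rewrite /grad_cmi /alt4 mulr0 add0r mulrC; congr (_ / _); ring.
Unshelve. all: by end_near. Qed.

Lemma partial_cmi x t : (forall s, 0 < x s) ->
  partial cond_mutual_info t x = grad_cmi x t.
Proof.
move=> x0; rewrite /partial derive1E.
by have /@derive_val := has_deriv_cmi t x0.
Qed.

Lemma has_deriv_ln_pushv (U : finType) (f : triple -> U) x s t :
  (forall s, 0 < x s) ->
  has_deriv (fun h => ln (pushv f (fun r => x r + h * basis_vec R s r) (f t))) 0
    ((f s == f t)%:R / pushv f x (f t)).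
Proof.
move=> x0; have p0 := pushv_gt0 f t x0.
under eq_fun do rewrite pushv_shift.
have p00 : 0 < pushv f x (f t) + 0 * (f s == f t)%:R by rewrite mul0r addr0.
apply: has_deriv_eq; first by has_deriv_tac.
by rewrite !(mul0r, mulr0, add0r, addr0, mulr1).
Qed.

Lemma hessian_cmi x s t : (forall s, 0 < x s) ->
  hessian cond_mutual_info x s t
  = alt4 (fun U f => (f s == f t)%:R / pushv f x (f t)) / ln 2.
Proof.
move=> x0; rewrite /hessian /partial -/(partial _ _ _) derive1E.
apply: derive_val; rewrite -/(has_deriv _ _ _).
apply: (@near_eq_has_deriv _
  (fun h => grad_cmi (fun r => x r + h * basis_vec R s r) t)).
  near=> h; apply: esym; apply: partial_cmi; near: h; exact: shift_gt0_near.
have d1 := has_deriv_ln_pushv id s t x0; have d2 := has_deriv_ln_pushv pi2 s t x0.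
have d3 := has_deriv_ln_pushv pi12 s t x0.
have d4 := has_deriv_ln_pushv pi23 s t x0.
have d := has_derivM (has_derivD (has_derivD (has_derivD d1 d2)
  (has_derivN d3)) (has_derivN d4)) (has_deriv_cst (ln 2)^-1 0).
apply: (has_deriv_eq d).
by rewrite /alt4 mulr0 add0r mulrC.
Unshelve. all: by end_near. Qed.

End Entropy.

(** * Cauchy-Schwarz inequalities *)

Section FiniteSums.
Context {R : realType} {I : finType}.
Implicit Types (P : pred I) (a p u w : I -> R).

(** The difference of the two sides is the [p]-weighted variance of the ratios [a i / p i], whose
    mean is [S / s]. *)
Lemma sqr_sum_div_le P a p : (forall i, P i -> 0 < p i) ->
  (\sum_(i | P i) a i) ^+ 2 / (\sum_(i | P i) p i)
  <= \sum_(i | P i) a i ^+ 2 / p i.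
Proof.
move=> p0; set S := \sum_(i | P i) a i; set s := \sum_(i | P i) p i.
have rhs0 : 0 <= \sum_(i | P i) a i ^+ 2 / p i.
  by apply: sumr_ge0 => i /p0 pi0; rewrite divr_ge0 ?sqr_ge0// ltW.
have [->|s0] := eqVneq s 0; first by rewrite invr0 mulr0.
rewrite -subr_ge0.
suff -> : \sum_(i | P i) a i ^+ 2 / p i - S ^+ 2 / s
    = \sum_(i | P i) (a i / p i - S / s) ^+ 2 * p i.
  by apply: sumr_ge0 => i /p0 pi0; rewrite mulr_ge0 ?sqr_ge0// ltW.
transitivity (\sum_(i | P i) (a i ^+ 2 / p i - 2 * (S / s) * a i
              + (S / s) ^+ 2 * p i)); last first.
  by apply: eq_bigr => i /p0 pi0; field; rewrite s0 gt_eqF.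
by rewrite big_split/= sumrB -!mulr_sumr -/S -/s; field.
Qed.

Lemma cauchy_schwarz_sum u w :
  (\sum_i u i * w i) ^+ 2 <= (\sum_i u i ^+ 2) * (\sum_i w i ^+ 2).
Proof.
set C := \sum_i u i * w i; set A := \sum_i u i ^+ 2; set B := \sum_i w i ^+ 2.
have B0 : 0 <= B by apply: sumr_ge0 => i _; exact: sqr_ge0.
have : 0 <= \sum_i (u i * B - w i * C) ^+ 2.
  by apply: sumr_ge0 => i _; exact: sqr_ge0.
have -> : \sum_i (u i * B - w i * C) ^+ 2 = B * (A * B - C ^+ 2).
  transitivity (\sum_i (B ^+ 2 * u i ^+ 2 - 2 * B * C * (u i * w i)
                + C ^+ 2 * w i ^+ 2)); first by apply: eq_bigr => i _; ring.
  by rewrite big_split/= sumrB -!mulr_sumr -/A -/B -/C; ring.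
have [Bz _|Bn0] := eqVneq B 0; last first.
  by rewrite pmulr_rge0 ?subr_ge0// lt_neqAle eq_sym Bn0.
suff -> : C = 0 by rewrite Bz mulr0 expr0n.
apply: big1 => i _; move/eqP: Bz; rewrite psumr_eq0 => [|k _]; last exact: sqr_ge0.
by move=> /allP/(_ i (mem_index_enum _))/=; rewrite sqrf_eq0 => /eqP ->; rewrite mulr0.
Qed.

End FiniteSums.

(** * Operator norms through quadratic forms, and the form of the Hessian *)

Section Operators.
Context {R : realType}.
Implicit Types (v w x : vec R) (A : triple -> triple -> R).

Lemma sqr_norm2 v : norm2 v ^+ 2 = \sum_t v t ^+ 2.
Proof. by rewrite sqr_sqrtr// sumr_ge0// => t _; exact: sqr_ge0. Qed.

Lemma norm2_ge0 v : 0 <= norm2 v. Proof. exact: sqrtr_ge0. Qed.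

Lemma dotv_le v w : dotv v w <= norm2 v * norm2 w.
Proof.
apply: le_trans (ler_norm _) _; rewrite -ler_sqr ?nnegrE ?mulr_ge0 ?norm2_ge0//.
by rewrite real_normK ?num_real// exprMn !sqr_norm2; exact: cauchy_schwarz_sum.
Qed.

Lemma norm2Z c v : norm2 (fun t => c * v t) = `|c| * norm2 v.
Proof.
rewrite /norm2; under eq_bigr do rewrite exprMn.
by rewrite -mulr_sumr sqrtrM ?sqr_ge0// sqrtr_sqr.
Qed.

Lemma mulmvZ A c v : mulmv A (fun t => c * v t) = (fun t => c * mulmv A v t).
Proof.
apply/funext => s; rewrite /mulmv mulr_sumr; apply: eq_bigr => t _; ring.
Qed.

Lemma dotv_mulmv_sym A v w : (forall s t, A s t = A t s) ->
  dotv v (mulmv A w) = dotv w (mulmv A v).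
Proof.
move=> Asym; rewrite /dotv /mulmv; under eq_bigr do rewrite mulr_sumr.
rewrite exchange_big/=; apply: eq_bigr => t _; rewrite mulr_sumr.
by apply: eq_bigr => s _; rewrite Asym; ring.
Qed.

Lemma dotv_mulmv_polar A v w : (forall s t, A s t = A t s) ->
  4 * dotv w (mulmv A v)
  = dotv (fun t => v t + w t) (mulmv A (fun t => v t + w t))
    - dotv (fun t => v t - w t) (mulmv A (fun t => v t - w t)).
Proof.
move=> Asym.
suff -> : dotv (fun t => v t + w t) (mulmv A (fun t => v t + w t))
    - dotv (fun t => v t - w t) (mulmv A (fun t => v t - w t))
  = 2 * (dotv v (mulmv A w) + dotv w (mulmv A v)).
  by rewrite (dotv_mulmv_sym v w Asym); ring.
have mD c : mulmv A (fun t => v t + c * w t)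
    = fun t => mulmv A v t + c * mulmv A w t.
  apply/funext => s; rewrite /mulmv mulr_sumr -big_split/=.
  by apply: eq_bigr => t _; ring.
have m1 := mD 1; have mN := mD (-1).
have -> : (fun t => v t + w t) = (fun t => v t + 1 * w t).
  by apply/funext => t; rewrite mul1r.
have -> : (fun t => v t - w t) = (fun t => v t + -1 * w t).
  by apply/funext => t; rewrite mulN1r.
rewrite m1 mN /dotv -big_split/= -sumrB mulr_sumr; apply: eq_bigr => t _; ring.
Qed.

(** For symmetric [A] the quadratic form controls the norm: polarize at [v] and [w = A v / |A v|],
    then apply the parallelogram law. The form is bounded on the whole space because [A v] may leave
    the tangent space. *)
Lemma norm2_mulmv_le A (L : R) v : (forall s t, A s t = A t s) -> 0 <= L ->
  (forall w, `|dotv w (mulmv A w)| <= L * norm2 w ^+ 2) ->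
  norm2 v <= 1 -> norm2 (mulmv A v) <= L.
Proof.
move=> Asym L0 hL v1; set n := norm2 (mulmv A v).
have n0 : 0 <= n := norm2_ge0 _.
have [-> //|nn0] := eqVneq n 0.
have np : 0 < n by rewrite lt_neqAle eq_sym nn0.
pose w t := n^-1 * mulmv A v t.
have wE : dotv w (mulmv A v) = n.
  rewrite /dotv /w; under eq_bigr do rewrite -mulrA -expr2.
  by rewrite -mulr_sumr -sqr_norm2 -/n expr2 mulKf.
have w1 : norm2 w = 1 by rewrite /w norm2Z -/n ger0_norm ?invr_ge0// mulVf.
have := dotv_mulmv_polar v w Asym; rewrite wE.
have := hL (fun t => v t + w t); have := hL (fun t => v t - w t).
have par : norm2 (fun t => v t + w t) ^+ 2 + norm2 (fun t => v t - w t) ^+ 2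
    = 2 * (norm2 v ^+ 2 + norm2 w ^+ 2).
  rewrite !sqr_norm2 -!big_split/= mulr_sumr; apply: eq_bigr => t _; ring.
rewrite !ler_norml => /andP[h1 _] /andP[_ h2] h3.
have : 4 * n <= L * (2 * (norm2 v ^+ 2 + norm2 w ^+ 2)).
  by rewrite -par mulrDr; lra.
rewrite w1 expr1n.
have v2 : norm2 v ^+ 2 <= 1 by rewrite expr_le1 ?norm2_ge0.
have := ler_wpM2l L0 v2; lra.
Qed.

Section OpnormTangent.
Variables (A : triple -> triple -> R) (L : R).
Hypotheses (Asym : forall s t, A s t = A t s) (L0 : 0 <= L).
Hypothesis hL : forall w, `|dotv w (mulmv A w)| <= L * norm2 w ^+ 2.

Lemma opnorm_tangent_le : opnorm_on (tangent R) A <= L.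
Proof.
apply: ge_sup; last first.
  by move=> _ [v [_ v1] <-]; exact: norm2_mulmv_le.
exists (norm2 (mulmv A (fun=> 0))), (fun=> 0) => //; split.
  by rewrite /tangent/= big1.
by rewrite /norm2 big1 ?sqrtr0// => t _; rewrite expr0n.
Qed.

(** The section's [L] enters to make the set of norms bounded, so that its [sup] is a genuine
    supremum. *)
Lemma opnorm_tangent_ge v : tangent R v ->
  dotv v (mulmv A v) <= opnorm_on (tangent R) A * norm2 v ^+ 2.
Proof.
move=> vT; have [n0|n0] := eqVneq (norm2 v) 0.
  by have := dotv_le v (mulmv A v); rewrite n0 mul0r expr0n mulr0.
have np : 0 < norm2 v by rewrite lt_neqAle eq_sym n0 norm2_ge0.
have : norm2 (mulmv A (fun t => (norm2 v)^-1 * v t)) <= opnorm_on (tangent R) A.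
  apply: ub_le_sup.
    by exists L => _ [w [_ w1] <-]; exact: norm2_mulmv_le.
  exists (fun t => (norm2 v)^-1 * v t) => //; split.
    by rewrite /tangent/= -mulr_sumr vT mulr0.
  by rewrite norm2Z ger0_norm ?invr_ge0 ?norm2_ge0// mulVf.
rewrite mulmvZ norm2Z ger0_norm ?invr_ge0 ?norm2_ge0// => h.
apply: le_trans (dotv_le _ _) _.
rewrite expr2 mulrA mulrC ler_pM2r//.
by rewrite -ler_pdivrMr// mulrC.
Qed.

End OpnormTangent.

Section HessianForm.
Variable p : vec R.
Hypothesis p0 : forall t, 0 < p t.

(** The chi-square (Fisher) form at [p] of the coarse-graining [f]: the second derivative of
    [ent f]. *)
Definition chi2 (U : finType) (f : triple -> U) v w : R :=
  \sum_u pushv f v u * (pushv f w u / pushv f p u).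

Local Notation H := (hessian cond_mutual_info p).

Lemma hessian_cmi_sym s t : H s t = H t s.
Proof.
have E (U : finType) (f : triple -> U) : (f s == f t)%:R / pushv f p (f t)
    = (f t == f s)%:R / pushv f p (f s).
  by rewrite (eq_sym (f t)); case: eqP => [->|]; rewrite ?mul0r.
by rewrite !hessian_cmi// /alt4 !E.
Qed.

Lemma mulmv_hessian v s :
  mulmv H v s = alt4 (fun U f => pushv f v (f s) / pushv f p (f s)) / ln 2.
Proof.
have E (U : finType) (f : triple -> U) :
    \sum_t (f s == f t)%:R / pushv f p (f t) * v t
    = pushv f v (f s) / pushv f p (f s).
  rewrite [X in _ = X / _]/pushv mulr_suml [RHS]big_mkcond/=.
  apply: eq_bigr => t _; rewrite eq_sym.
  by case: eqP => [->|]; rewrite ?mul1r ?mul0r// mulrC.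
rewrite /mulmv; under eq_bigr do rewrite hessian_cmi// /alt4.
rewrite /alt4 -!E -big_split/= -!sumrB mulr_suml.
by apply: eq_bigr => t _; ring.
Qed.

Lemma dotv_hessian v w :
  dotv v (mulmv H w) = alt4 (fun U f => chi2 f v w) / ln 2.
Proof.
have E (U : finType) (f : triple -> U) :
    chi2 f v w = \sum_t v t * (pushv f w (f t) / pushv f p (f t)).
  by rewrite /chi2 (sum_pushvM f v (fun u => pushv f w u / pushv f p u)).
rewrite /alt4 !E -big_split/= -!sumrB mulr_suml; apply: eq_bigr => t _.
by rewrite mulmv_hessian /alt4; ring.
Qed.

Lemma chi2_ge0 (U : finType) (f : triple -> U) v : 0 <= chi2 f v v.
Proof.
apply: sumr_ge0 => u _; rewrite mulrA -expr2 divr_ge0 ?sqr_ge0//.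
by apply: pushv_ge0 => s; exact: ltW.
Qed.

Lemma chi2_id v : chi2 id v v = \sum_t v t ^+ 2 / p t.
Proof. by apply: eq_bigr => t _; rewrite !pushv_id mulrA -expr2. Qed.

(** Chi-square decreases under coarse-graining: [sqr_sum_div_le] on each fibre. *)
Lemma chi2_pi12_le v : chi2 pi12 v v <= chi2 id v v.
Proof.
rewrite chi2_id (partition_big pi12 xpredT)//=; apply: ler_sum => u _.
by rewrite mulrA -expr2; apply: sqr_sum_div_le.
Qed.

Lemma pushv_pi2 v j : pushv pi2 v j = \sum_(i : 'I_9) pushv pi12 v (i, j).
Proof. by rewrite -marg2E; apply: eq_bigr => i _; rewrite -marg12E. Qed.

Lemma pushv_pi12_gt0 v u : (forall t, 0 < v t) -> 0 < pushv pi12 v u.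
Proof. by move=> v0; exact: (pushv_gt0 pi12 (u, ord0)). Qed.

Lemma chi2_pi2_le v : chi2 pi2 v v <= chi2 pi12 v v.
Proof.
have -> : chi2 pi12 v v = \sum_j \sum_(i : 'I_9)
    pushv pi12 v (i, j) ^+ 2 / pushv pi12 p (i, j).
  rewrite exchange_big/= pair_bigA/=; apply: eq_bigr => -[i j] _.
  by rewrite mulrA -expr2.
apply: ler_sum => j _; rewrite mulrA -expr2 !pushv_pi2.
by apply: sqr_sum_div_le => i _; exact: pushv_pi12_gt0.
Qed.

Lemma sum_pi23 (f : triple -> R) :
  \sum_t f t = \sum_j \sum_k \sum_(i : 'I_9) f (i, j, k).
Proof.
rewrite sum_triple exchange_big/=; apply: eq_bigr => j _.
by rewrite exchange_big.
Qed.

Lemma chi2_pi23 v : chi2 pi23 v v = \sum_j \sum_k marg23 v j k ^+ 2 / marg23 p j k.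
Proof.
rewrite pair_bigA/=; apply: eq_bigr => -[j k] _.
by rewrite !marg23E mulrA -expr2.
Qed.

Lemma marg23_sqr_le v j k :
  marg23 v j k ^+ 2 <= 9 * \sum_(i : 'I_9) v (i, j, k) ^+ 2.
Proof.
have := @sqr_sum_div_le R 'I_9 xpredT (fun i => v (i, j, k)) (fun=> 1).
move=> /(_ (fun _ _ => ltr01)); rewrite sumr_const card_ord ler_pdivrMr ?ltr0n//.
by rewrite [leRHS]mulrC; under [X in _ * X]eq_bigr do rewrite divr1.
Qed.

Variable c : R.
Hypothesis c_marg : forall j k, 9 / marg23 p j k <= c.

Lemma chi2_pi23_le v : chi2 pi23 v v <= c * norm2 v ^+ 2.
Proof.
rewrite chi2_pi23 sqr_norm2 sum_pi23 mulr_sumr; apply: ler_sum => j _.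
rewrite mulr_sumr; apply: ler_sum => k _.
have m0 : 0 < marg23 p j k by rewrite marg23E (pushv_gt0 pi23 (ord0, j, k)).
have s0 : 0 <= \sum_(i : 'I_9) v (i, j, k) ^+ 2.
  by apply: sumr_ge0 => i _; exact: sqr_ge0.
apply: le_trans (ler_wpM2r s0 (c_marg j k)).
rewrite [leRHS]mulrAC ler_pM2r ?invr_gt0//; exact: marg23_sqr_le.
Qed.

Variable L : R.
Hypotheses (cL : c <= L * ln 2).
Hypothesis fibre_le : forall v j k,
  \sum_(i : 'I_9) v (i, j, k) ^+ 2 / p (i, j, k) - marg23 v j k ^+ 2 / marg23 p j k
  <= L * ln 2 * \sum_(i : 'I_9) v (i, j, k) ^+ 2.

(** The absolute value needs a lower side as well: there [chi2 id - chi2 pi12] and [chi2 pi2] are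
    nonnegative, and [c] controls the remaining [- chi2 pi23]. The upper side is where [fibre_le] is
    needed. *)
Lemma hessian_form_le v : `|dotv v (mulmv H v)| <= L * norm2 v ^+ 2.
Proof.
have l2 := @ln2_gt0 R.
rewrite dotv_hessian normf_div (gtr0_norm l2) ler_pdivrMr// mulrAC ler_norml /alt4.
have h1 := chi2_pi12_le v; have h2 := chi2_pi2_le v; have h3 := chi2_ge0 pi2 v.
have h4 := chi2_pi23_le v; have h5 := chi2_ge0 pi12 v.
have h6 : chi2 id v v - chi2 pi23 v v <= L * ln 2 * norm2 v ^+ 2.
  rewrite chi2_id chi2_pi23 sqr_norm2 !sum_pi23 -sumrB mulr_sumr.
  apply: ler_sum => j _; rewrite -sumrB mulr_sumr; apply: ler_sum => k _.
  exact: fibre_le.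
have := ler_wpM2r (sqr_ge0 (norm2 v)) cL.
lra.
Qed.

End HessianForm.
End Operators.

(** * Transfer of binary integer computations to the reals *)

Section ZtoR.
Context {R : realType}.

Definition zr (z : Z) : R := (int_of_Z z)%:~R.

Lemma zrD a b : zr (a + b)%BZ = zr a + zr b.
Proof. by rewrite /zr -rmorphD -raddfD. Qed.

Lemma zrM a b : zr (a * b)%BZ = zr a * zr b.
Proof. by rewrite /zr -rmorphM -[in RHS]rmorphM. Qed.

Lemma zrN a : zr (- a)%BZ = - zr a.
Proof. by rewrite /zr -rmorphN -[in RHS]raddfN. Qed.

Lemma zrB a b : zr (a - b)%BZ = zr a - zr b.
Proof. by rewrite /Z.sub zrD zrN. Qed.

Lemma zr_nat n : zr (Z.of_nat n) = n%:R.
Proof. by rewrite /zr -[Z.of_nat n]/(Z_of_int n) Z_of_intK. Qed.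

Lemma zr0 : zr 0%BZ = 0. Proof. by []. Qed.
Lemma zr1 : zr 1%BZ = 1. Proof. by []. Qed.

Lemma zr_ge0 a : (0 <= a)%BZ -> 0 <= zr a.
Proof. by case: a => // p _; rewrite /zr ler0z. Qed.

Lemma zr_le a b : (a <= b)%BZ -> zr a <= zr b.
Proof. by move=> ab; rewrite -subr_ge0 -zrB; apply: zr_ge0; lia. Qed.

Lemma zr_lt a b : (a < b)%BZ -> zr a < zr b.
Proof.
move=> ab; apply: (@lt_le_trans _ _ (zr a + 1)); first by rewrite ltrDl.
by rewrite -zr1 -zrD; apply: zr_le; lia.
Qed.

Lemma zrX a (n : nat) : zr (a ^ Z.of_nat n)%BZ = zr a ^+ n.
Proof.
elim: n => [|n ih]; first by rewrite expr0.
by rewrite Nat2Z.inj_succ Z.pow_succ_r; [rewrite zrM ih exprS|lia].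
Qed.

Lemma zr_div_le a b : (0 < b)%BZ -> zr (a / b)%BZ <= zr a / zr b.
Proof.
move=> b0; rewrite ler_pdivlMr; last exact: (zr_lt b0).
rewrite -zrM; apply: zr_le; have := Z.mul_div_le a b b0; lia.
Qed.

Lemma zr_div_ge a b : (0 < b)%BZ -> zr a / zr b <= zr (a / b + 1)%BZ.
Proof.
move=> b0; rewrite ler_pdivrMr; last exact: (zr_lt b0).
rewrite -zrM; apply: zr_le; have := Z.mul_succ_div_gt a b b0; lia.
Qed.

End ZtoR.

(** * Enclosures of [ln (1 + 1 / n)], [ln 2] and [ln 10] *)

Section LogInv.
Context {R : realType}.
Implicit Types n : nat.

Definition lnS n : R := ln (1 + 1 / n%:R).

(** This [z] solves [1 + 1 / n = (1 + z) / (1 - z)], which brings in the artanh bounds. *)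
Let lnSE n : (0 < n)%N -> let z := 1 / (2 * n%:R + 1) in
  0 <= z < 1 /\ lnS n = ln (1 + z) - ln (1 - z) :> R.
Proof.
move=> n0 z; have n0R : 0 < n%:R :> R by rewrite ltr0n.
have N0 : 0 < 2 * n%:R + 1 :> R by lra.
have z1 : 0 <= z < 1.
  by rewrite /z divr_ge0 ?ltW//= ltr_pdivrMr//; lra.
split=> //; rewrite -ln_div ?posrE; [|lra|lra].
congr ln; rewrite /z; field; rewrite !gt_eqF//=; lra.
Qed.

Lemma lnS_lower n : (0 < n)%N ->
  2 / (2 * n%:R + 1) * (1 + 1 / (3 * (2 * n%:R + 1) ^+ 2)) <= lnS n.
Proof.
move=> n0; have n0R : 0 < n%:R :> R by rewrite ltr0n.
have [z1 ->] := lnSE n0; apply: le_trans (ln_ratio_lower z1).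
rewrite le_eqVlt; apply/orP; left; apply/eqP.
by field; rewrite gt_eqF//; lra.
Qed.

Lemma lnS_upper n : (0 < n)%N ->
  lnS n <= 2 / (2 * n%:R + 1) * (1 + 1 / (12 * n%:R * (n%:R + 1))).
Proof.
move=> n0; have n0R : 0 < n%:R :> R by rewrite ltr0n.
have [z1 ->] := lnSE n0; apply: le_trans (ln_ratio_upper z1) _.
rewrite le_eqVlt; apply/orP; left; apply/eqP.
have N0 : 2 * n%:R + 1 != 0 :> R by rewrite gt_eqF//; lra.
have -> : 1 - (1 / (2 * n%:R + 1)) ^+ 2
    = 4 * n%:R * (n%:R + 1) / (2 * n%:R + 1) ^+ 2 :> R by field.
by field; rewrite N0 !gt_eqF//=; lra.
Qed.

Lemma lnS_ge n : (0 < n)%N -> 2 / (2 * n%:R + 1) <= lnS n.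
Proof.
move=> n0; have n0R : 0 < n%:R :> R by rewrite ltr0n.
apply: le_trans (lnS_lower n0); rewrite ler_peMr//.
by rewrite lerDl divr_ge0// mulr_ge0// sqr_ge0.
Qed.

Lemma lnS_gt0 n : (0 < n)%N -> 0 < lnS n.
Proof. by move=> n0; rewrite ln_gt0// ltrDl divr_gt0 ?ltr0n. Qed.

Lemma lnS_le_inv n : lnS n <= 1 / n%:R.
Proof. by apply: le_ln1Dx; rewrite (lt_le_trans _ (divr_ge0 _ _)). Qed.

Lemma inv_lnS_le n : (0 < n)%N -> (lnS n)^-1 <= n%:R + 1 / 2.
Proof.
move=> n0; have n0R : 0 < n%:R :> R by rewrite ltr0n.
have h := lnS_ge n0.
have N0 : 0 < 2 / (2 * n%:R + 1) :> R by rewrite divr_gt0//; lra.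
apply: (@le_trans _ _ (2 / (2 * n%:R + 1))^-1).
  by rewrite lef_pV2 ?posrE// lnS_gt0.
rewrite le_eqVlt; apply/orP; left; apply/eqP; field; rewrite gt_eqF//; lra.
Qed.

Lemma lnS_anti m n : (0 < m)%N -> (m <= n)%N -> lnS n <= lnS m.
Proof.
move=> m0 mn; have n0 := leq_trans m0 mn.
rewrite ler_ln ?posrE ?addr_gt0 ?divr_gt0 ?ltr0n// lerD2l.
by rewrite !div1r lef_pV2 ?posrE ?ltr0n// ler_nat.
Qed.

Lemma lnS_telescope n m : (0 < n)%N -> \sum_(k < m) lnS (n + k) =
  ln (n + m)%:R - ln n%:R :> R.
Proof.
move=> n0; elim: m => [|m ih]; first by rewrite big_ord0 addn0 subrr.
rewrite big_ord_recr/= ih /lnS.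
have nm : 0 < (n + m)%:R :> R by rewrite ltr0n addn_gt0 n0.
have -> : 1 + 1 / (n + m)%:R = (n + m).+1%:R / (n + m)%:R :> R.
  by rewrite -[in RHS]natr1 mulrDl divff ?gt_eqF.
rewrite ln_div ?posrE// ?ltr0n// addnS; ring.
Qed.

(** Benford's law is consistent when the last digit is dropped. Hence the (12)-marginal is a single
    logarithm, while the marginals over the leading digit remain sums of nine. *)
Lemma lnS_decade n : (0 < n)%N -> \sum_(k < 10) lnS (10 * n + k) = lnS n.
Proof.
move=> n0; have n10 : (0 < 10 * n)%N by rewrite muln_gt0.
have n1010 : (0 < 10 * n + 10)%N by rewrite addn_gt0 n10.
rewrite lnS_telescope//.
have nR : 0 < n%:R :> R by rewrite ltr0n.
rewrite -ln_div ?posrE ?(ltr0n _ n) ?ltr0n// /lnS; congr ln.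
by rewrite natrD natrM; field; rewrite gt_eqF.
Qed.

Lemma ln10_gt0 : 0 < ln (10 : R). Proof. by rewrite ln_gt0// ltr1n. Qed.

(* [643 / 2136 < log10 2 < 146 / 485] are convergents of [log10 2]. *)
Lemma ln10_le_ln2 : 643 * ln 10 <= 2136 * ln (2 : R).
Proof.
rewrite !mulr_natl -!lnXn// ler_ln ?posrE ?exprn_gt0//.
have -> : 10 = zr 10%BZ :> R by rewrite -(zr_nat 10).
have -> : 2 = zr 2%BZ :> R by rewrite -(zr_nat 2).
by rewrite -!zrX; apply: zr_le; vm_compute.
Qed.

Lemma ln2_le_ln10 : 485 * ln 2 <= 146 * ln (10 : R).
Proof.
rewrite !mulr_natl -!lnXn// ler_ln ?posrE ?exprn_gt0//.
have -> : 10 = zr 10%BZ :> R by rewrite -(zr_nat 10).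
have -> : 2 = zr 2%BZ :> R by rewrite -(zr_nat 2).
by rewrite -!zrX; apply: zr_le; vm_compute.
Qed.

(** The classical formula from [16/15], [25/24] and [81/80]: all three are near 1, where the
    enclosures are sharp, and their only prime factors are 2, 3 and 5. *)
Lemma ln2E : ln 2 = 7 * lnS 15 + 5 * lnS 24 + 3 * lnS 80 :> R.
Proof.
rewrite /lnS !mulr_natl -!lnXn ?addr_gt0 ?divr_gt0//.
rewrite -!lnM ?posrE ?mulr_gt0 ?exprn_gt0 ?addr_gt0 ?divr_gt0//.
by congr ln; field.
Qed.

(** [N] and [M] are parameters and the powers are written as repeated divisions, so that instances
    consist of small numerals fit for [lra]. *)
Lemma lnS_bounds n N M : (0 < n)%N -> N = (2 * n + 1)%N -> M = n.+1 ->
  2 / N%:R * (1 + 1 / 3 / N%:R / N%:R) <= lnS n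
  <= 2 / N%:R * (1 + 1 / 12 / n%:R / M%:R).
Proof.
move=> n0 -> ->; have n0R : 0 < n%:R :> R by rewrite ltr0n.
have N0 : 2 * n%:R + 1 != 0 :> R by rewrite gt_eqF//; lra.
rewrite -natr1 natrD natrM; apply/andP; split.
  apply: le_trans (lnS_lower n0); rewrite le_eqVlt; apply/orP; left; apply/eqP.
  by field.
apply: le_trans (lnS_upper n0) _; rewrite le_eqVlt; apply/orP; left; apply/eqP.
by field; rewrite N0 !gt_eqF//=; lra.
Qed.

(** Both bounds are convergents of the continued fraction of [ln 2]. *)
Lemma ln2_bounds : 192 / 277 <= ln (2 : R) <= 253 / 365.
Proof.
rewrite ln2E.
have /andP[] := @lnS_bounds 15 31 16 isT erefl erefl.
have /andP[] := @lnS_bounds 24 49 25 isT erefl erefl.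
have /andP[] := @lnS_bounds 80 161 81 isT erefl erefl.
lra.
Qed.

End LogInv.

(** * Quadratic forms of type diagonal minus rank one *)

Section RankOne.
Context {R : realType}.

(** Only the last diagonal entry may exceed [L], and the last hypothesis is the secular condition
    [x (s + tau) <= 1]. With [v_max = S - T], it follows from two Cauchy-Schwarz inequalities that
    can be equalities at once, so nothing is lost. *)
Lemma rank_one_bound n (d v : 'I_n.+1 -> R) (s L : R) :
  0 < s ->
  (forall i : 'I_n.+1, i != ord_max -> d i < L) ->
  (d ord_max - L) * (s + \sum_(i < n.+1 | i != ord_max) (L - d i)^-1) <= 1 ->
  \sum_i v i ^+ 2 * d i - (\sum_i v i) ^+ 2 / s <= L * \sum_i v i ^+ 2.
Proof.
move=> s0 dL; set tau := \sum_(i < n.+1 | _) _ => hx.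
set S := \sum_i v i; set x := d ord_max - L.
pose T := \sum_(i < n.+1 | i != ord_max) v i.
have tau0 : 0 <= tau.
  by apply: sumr_ge0 => i /dL h; rewrite invr_ge0 subr_ge0 ltW.
have vmax : v ord_max = S - T by rewrite /S (bigD1 ord_max)//= addrK.
have T_le : T ^+ 2 / tau <= \sum_(i < n.+1 | i != ord_max) (L - d i) * v i ^+ 2.
  apply: le_trans (sqr_sum_div_le (fun i => v i) _) _.
    by move=> i /dL h; rewrite invr_gt0 subr_gt0.
  by apply: ler_sum => i _; rewrite invrK mulrC.
have sq_le : (S - T) ^+ 2 <= (s + tau) * (S ^+ 2 / s + T ^+ 2 / tau).
  (* [tau] vanishes only if there is no index besides the last; then [T = 0]. *)
  have [t0|tn0] := eqVneq tau 0.
    have Tz : T = 0.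
      rewrite /T big1// => i im; exfalso.
      have : 0 < tau; last by rewrite t0 ltxx.
      rewrite /tau (bigD1 i)//= ltr_wpDr//.
        by apply: sumr_ge0 => k /andP[/dL h _]; rewrite invr_ge0 subr_ge0 ltW.
      by rewrite invr_gt0 subr_gt0 dL.
    rewrite Tz t0 subr0 expr0n mul0r !addr0.
    by rewrite mulrCA mulfV ?mulr1 ?gt_eqF.
  have tp : 0 < tau by rewrite lt_neqAle eq_sym tn0.
  rewrite -subr_ge0.
  have -> : (s + tau) * (S ^+ 2 / s + T ^+ 2 / tau) - (S - T) ^+ 2
      = (tau * S + s * T) ^+ 2 / (s * tau).
    by field; rewrite tn0 gt_eqF.
  by rewrite divr_ge0 ?sqr_ge0// mulr_ge0 ?ltW.
have St0 : 0 <= S ^+ 2 / s + T ^+ 2 / tau.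
  by rewrite addr_ge0// divr_ge0 ?sqr_ge0// ltW.
have main : x * v ord_max ^+ 2 <= S ^+ 2 / s + T ^+ 2 / tau.
  have [x0|x0] := leP x 0.
    apply: le_trans St0; rewrite -oppr_ge0 -mulNr mulr_ge0 ?sqr_ge0//; lra.
  rewrite vmax; apply: (le_trans (ler_wpM2l (ltW x0) sq_le)).
  by rewrite mulrA; apply: ler_piMl.
rewrite (bigD1 ord_max)//= [X in _ <= _ * X](bigD1 ord_max)//=.
have := T_le.
have -> : \sum_(i < n.+1 | i != ord_max) (L - d i) * v i ^+ 2
  = L * (\sum_(i < n.+1 | i != ord_max) v i ^+ 2)
    - \sum_(i < n.+1 | i != ord_max) v i ^+ 2 * d i.
  by rewrite mulr_sumr -sumrB; apply: eq_bigr => i _; ring.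
move: main; rewrite /x; lra.
Qed.

End RankOne.

(** * The Benford distribution *)

Section Benford.
Context {R : realType}.

Definition delta (t : triple) : nat := (100 * dig1 t + 10 * dig2 t + dig3 t)%N.

Lemma delta_bounds t : (100 <= delta t <= 999)%N.
Proof.
case: t => [[i j] k]; rewrite /delta /dig1 /dig2 /dig3/=.
have := ltn_ord i; have := ltn_ord j; have := ltn_ord k; lia.
Qed.

Lemma delta_gt0 t : (0 < delta t)%N.
Proof. by have /andP[] := delta_bounds t; lia. Qed.

Lemma benfordE t : benford R t = lnS (delta t) / ln 10.
Proof. by []. Qed.

Lemma benford_gt0 t : 0 < benford R t.
Proof. by rewrite benfordE divr_gt0 ?ln10_gt0 ?lnS_gt0 ?delta_gt0. Qed.

Lemma p_minE : p_min R = lnS 999 / ln 10.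
Proof.
have l10 := @ln10_gt0 R.
have le t : lnS 999 / ln 10 <= benford R t.
  rewrite benfordE ler_pM2r ?invr_gt0// lnS_anti ?delta_gt0//.
  by have /andP[] := delta_bounds t.
apply/eqP; rewrite eq_le; apply/andP; split; last by rewrite /p_min le_bigmin.
rewrite /p_min; exact: (bigmin_le _ (ord_max, ord_max, ord_max)).
Qed.

Lemma p_min_le t : p_min R <= benford R t.
Proof.
rewrite p_minE benfordE ler_pM2r ?invr_gt0 ?ln10_gt0// lnS_anti ?delta_gt0//.
by have /andP[] := delta_bounds t.
Qed.

Lemma p_min_gt0 : 0 < p_min R.
Proof. by rewrite p_minE divr_gt0 ?ln10_gt0 ?lnS_gt0. Qed.

(** [4.35 * 10^-4] is read as a rounded value: the tolerance is half a unit of its last digit. *)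
Lemma p_min_approx : `|p_min R - 435 / 10 ^+ 6| <= 5 / 10 ^+ 7.
Proof.
have l10 := @ln10_gt0 R.
have /andP[h1 h2] := @ln2_bounds R.
have h3 := @ln10_le_ln2 R; have h4 := @ln2_le_ln10 R.
have /andP[h5 h6] := @lnS_bounds R 999 1999 1000 isT erefl erefl.
have e1 : 435 / 10 ^+ 6 = 435 / 1000 / 1000 :> R by field.
have e2 : 5 / 10 ^+ 7 = 5 / 1000 / 1000 / 10 :> R by field.
have a1 : 4345 / 1000 / 1000 / 10 <= p_min R.
  by rewrite p_minE ler_pdivlMr//; clear h1 h4 h6 e1 e2; lra.
have a2 : p_min R <= 4355 / 1000 / 1000 / 10.
  by rewrite p_minE ler_pdivrMr//; clear h2 h3 h5 e1 e2; lra.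
by rewrite ler_norml e1 e2; move: a1 a2; clear; lra.
Qed.

Lemma sum_benford : \sum_t benford R t = 1.
Proof.
have l10 := @ln10_gt0 R.
have -> : \sum_t benford R t = (\sum_t lnS (delta t)) / ln 10.
  by rewrite mulr_suml; apply: eq_bigr => t _; rewrite benfordE.
suff -> : \sum_t lnS (delta t) = ln 10 :> R by rewrite divff ?gt_eqF.
rewrite sum_triple.
transitivity (\sum_(i < 9) \sum_(j < 10) lnS (10 * (1 + i) + j) : R).
  apply: eq_bigr => i _; apply: eq_bigr => j _.
  rewrite -(@lnS_decade R (10 * (1 + i) + j))//; apply: eq_bigr => k _.
  by congr lnS; rewrite /delta /dig1 /dig2 /dig3/=; lia.
under eq_bigr do rewrite lnS_decade//.
by rewrite lnS_telescope// ln1 subr0.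
Qed.

Lemma marg23_benford j k : marg23 (benford R) j k
  = (\sum_(i < 9) lnS (100 * i.+1 + (10 * j + k))) / ln 10.
Proof.
rewrite mulr_suml; apply: eq_bigr => i _; rewrite benfordE.
by congr (lnS _ / _); rewrite /delta /dig1 /dig2 /dig3/= addnA.
Qed.

(** The pair [(9, 9)] has the smallest (23)-marginal, so this value serves all pairs. *)
Lemma sum_lnS_99 : 193 / 10 ^+ 4 <= \sum_(i < 9) lnS (100 * i.+1 + 99) :> R.
Proof.
rewrite !big_ord_recl big_ord0/= /bump/= !add1n.
have -> : 193 / 10 ^+ 4 = 193 / 100 / 100 :> R by field.
have /andP[+ _] := @lnS_bounds R 199 399 200 isT erefl erefl.
have /andP[+ _] := @lnS_bounds R 299 599 300 isT erefl erefl.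
have /andP[+ _] := @lnS_bounds R 399 799 400 isT erefl erefl.
have /andP[+ _] := @lnS_bounds R 499 999 500 isT erefl erefl.
have /andP[+ _] := @lnS_bounds R 599 1199 600 isT erefl erefl.
have /andP[+ _] := @lnS_bounds R 699 1399 700 isT erefl erefl.
have /andP[+ _] := @lnS_bounds R 799 1599 800 isT erefl erefl.
have /andP[+ _] := @lnS_bounds R 899 1799 900 isT erefl erefl.
have /andP[+ _] := @lnS_bounds R 999 1999 1000 isT erefl erefl.
rewrite -[(100 * 1 + 99)%N]/199%N -[(100 * 2 + 99)%N]/299%N.
rewrite -[(100 * 3 + 99)%N]/399%N -[(100 * 4 + 99)%N]/499%N.
rewrite -[(100 * 5 + 99)%N]/599%N -[(100 * 6 + 99)%N]/699%N.
rewrite -[(100 * 7 + 99)%N]/799%N -[(100 * 8 + 99)%N]/899%N.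
rewrite -[(100 * 9 + 99)%N]/999%N.
lra.
Qed.
End Benford.

(** * Upper bound for the Hessian norm *)

Section HessianNorm.
Context {R : realType}.
Local Notation p := (benford R).

Lemma marg23_benford_ge j k : 193 / 10 ^+ 4 <= marg23 p j k * ln 10.
Proof.
rewrite marg23_benford divfK ?gt_eqF ?ln10_gt0//.
apply: (le_trans sum_lnS_99); apply: ler_sum => i _; apply: lnS_anti; first lia.
by have := ltn_ord j; have := ltn_ord k; lia.
Qed.

Lemma marg23_benford_inv_le j k : 9 / marg23 p j k <= 1573 * ln 2.
Proof.
have l10 := @ln10_gt0 R; have := @ln10_le_ln2 R.
have m0 : 0 < marg23 p j k.
  by rewrite marg23E (pushv_gt0 pi23 (ord0, j, k) benford_gt0).
rewrite ler_pdivrMr// => h2; have := ler_wpM2l (ltW m0) h2.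
have := marg23_benford_ge j k.
have -> : 193 / 10 ^+ 4 = 193 / 100 / 100 :> R by field.
lra.
Qed.

(* Upper bounds for [1 / (979.551 - 99.5 - 100 (i + 1))], where [979.551] is a
   lower bound for [3254 log10 2]. *)
Definition fibre_gap (i : nat) : R :=
  nth 0 [:: 1 / 780; 1 / 680; 1 / 580; 1 / 480; 1 / 380; 1 / 280; 20 / 3601;
            20 / 1601] i.

(** The secular condition at [(9, 9)], where [19.949 = 999.5 - 979.551]. It holds with a margin
    below [10^-4], hence the sharp enclosures. *)
Lemma fibre_num_99 :
  (19 + 949 / 1000) * (\sum_(i < 9) lnS (100 * i.+1 + 99)
                       + \sum_(i < 8) fibre_gap i) <= 1 :> R.
Proof.
rewrite !big_ord_recl !big_ord0/= /bump/= !add1n /fibre_gap/=.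
have /andP[_ +] := @lnS_bounds R 199 399 200 isT erefl erefl.
have /andP[_ +] := @lnS_bounds R 299 599 300 isT erefl erefl.
have /andP[_ +] := @lnS_bounds R 399 799 400 isT erefl erefl.
have /andP[_ +] := @lnS_bounds R 499 999 500 isT erefl erefl.
have /andP[_ +] := @lnS_bounds R 599 1199 600 isT erefl erefl.
have /andP[_ +] := @lnS_bounds R 699 1399 700 isT erefl erefl.
have /andP[_ +] := @lnS_bounds R 799 1599 800 isT erefl erefl.
have /andP[_ +] := @lnS_bounds R 899 1799 900 isT erefl erefl.
have /andP[_ +] := @lnS_bounds R 999 1999 1000 isT erefl erefl.
rewrite -[(100 * 1 + 99)%N]/199%N -[(100 * 2 + 99)%N]/299%N.
rewrite -[(100 * 3 + 99)%N]/399%N -[(100 * 4 + 99)%N]/499%N.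
rewrite -[(100 * 5 + 99)%N]/599%N -[(100 * 6 + 99)%N]/699%N.
rewrite -[(100 * 7 + 99)%N]/799%N -[(100 * 8 + 99)%N]/899%N.
rewrite -[(100 * 9 + 99)%N]/999%N.
lra.
Qed.

(** Covers all [10 j + k] from 80 to 98 at once: the first factor is taken at 98
    ([18.949 = 998.5 - 979.551]) and the marginal at 80, each at its worst end. *)
Lemma fibre_num_80 :
  (18 + 949 / 1000) * (\sum_(i < 9) lnS (100 * i.+1 + 80)
                       + \sum_(i < 8) fibre_gap i) <= 1 :> R.
Proof.
rewrite !big_ord_recl !big_ord0/= /bump/= !add1n /fibre_gap/=.
have := @lnS_le_inv R 180; have := @lnS_le_inv R 280.
have := @lnS_le_inv R 380; have := @lnS_le_inv R 480.
have := @lnS_le_inv R 580; have := @lnS_le_inv R 680.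
have := @lnS_le_inv R 780; have := @lnS_le_inv R 880.
have := @lnS_le_inv R 980.
rewrite -[(100 * 1 + 80)%N]/180%N -[(100 * 2 + 80)%N]/280%N.
rewrite -[(100 * 3 + 80)%N]/380%N -[(100 * 4 + 80)%N]/480%N.
rewrite -[(100 * 5 + 80)%N]/580%N -[(100 * 6 + 80)%N]/680%N.
rewrite -[(100 * 7 + 80)%N]/780%N -[(100 * 8 + 80)%N]/880%N.
rewrite -[(100 * 9 + 80)%N]/980%N.
lra.
Qed.

Lemma inv_benford_le t : (p t)^-1 <= ln 10 * ((delta t)%:R + 1 / 2).
Proof.
rewrite benfordE invf_div ler_pM2l ?ln10_gt0//.
exact/inv_lnS_le/delta_gt0.
Qed.

Lemma kappa_ge : ln 10 * (979 + 551 / 1000) <= 3254 * ln 2 :> R.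
Proof. by have := @ln10_le_ln2 R; have := @ln10_gt0 R; lra. Qed.

Lemma fibre_gap_inv n : (n < 8)%N -> 0 < fibre_gap n /\
  (fibre_gap n)^-1 <= 780 - 100 * n%:R + 51 / 1000.
Proof.
have E (a : R) : (1 / a)^-1 = a by rewrite div1r invrK.
have F (a : R) : (20 / a)^-1 = a / 20 by rewrite invf_div.
by case: n => [|[|[|[|[|[|[|[|//]]]]]]]] _; rewrite /fibre_gap /nth ?E ?F; split; lra.
Qed.

Lemma two_digits_le (j k : 'I_10) : (10 * j + k <= 99)%N.
Proof. by have := ltn_ord j; have := ltn_ord k; lia. Qed.

Lemma fibre_gap_ge (L : R) (i : 'I_9) j k :
  ln 10 * (979 + 551 / 1000) <= L -> i != ord_max ->
  (p (i, j, k))^-1 < L /\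
  (L - (p (i, j, k))^-1)^-1 <= fibre_gap i / ln 10.
Proof.
move=> h2 im; have l10 := @ln10_gt0 R.
have h1 := inv_benford_le (i, j, k).
have i8 : (i < 8)%N.
  by rewrite ltn_neqAle -ltnS ltn_ord andbT; move: im; rewrite -val_eqE.
have jk : ((10 * j + k)%N%:R : R) <= 99.
  by rewrite (ler_nat _ _ 99); exact: two_digits_le.
have dE : (delta (i, j, k))%:R = 100 * (i%:R + 1) + (10 * j + k)%N%:R :> R.
  by rewrite /delta /dig1 /dig2 /dig3/= -addnA natrD natrM natr1.
have [g0 gi] : 0 < fibre_gap i /\
    (fibre_gap i)^-1 + (delta (i, j, k))%:R + 1 / 2 <= 979 + 551 / 1000.
  by have [g0 gi] := fibre_gap_inv i8; split=> //; rewrite dE; lra.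
have gl : (fibre_gap i)^-1 * ln 10 <= L - (p (i, j, k))^-1.
  have := ler_wpM2l (ltW l10) gi; rewrite -addrA mulrDr mulrC; lra.
have g1 : 0 < (fibre_gap i)^-1 * ln 10 by rewrite mulr_gt0 ?invr_gt0.
split; first by rewrite -subr_gt0 (lt_le_trans g1 gl).
have -> : fibre_gap i / ln 10 = ((fibre_gap i)^-1 * ln 10)^-1.
  by rewrite invfM invrK.
by rewrite lef_pV2 ?posrE; [|exact: lt_le_trans gl|].
Qed.

Lemma fibre_le (L : R) (v : vec R) j k :
  ln 10 * (979 + 551 / 1000) <= L ->
  \sum_(i : 'I_9) v (i, j, k) ^+ 2 / p (i, j, k)
    - marg23 v j k ^+ 2 / marg23 p j k
  <= L * \sum_(i : 'I_9) v (i, j, k) ^+ 2.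
Proof.
move=> h2; have l10 := @ln10_gt0 R.
have m0 : 0 < marg23 p j k.
  by rewrite marg23E (pushv_gt0 pi23 (ord0, j, k) benford_gt0).
apply: (@rank_one_bound R 8 (fun i => (p (i, j, k))^-1) (fun i => v (i, j, k))) => //.
  by move=> i im; have [] := fibre_gap_ge j k h2 im.
set x := _ - _; set tau := \sum_(i < 9 | _) _.
have tau0 : 0 <= tau.
  apply: sumr_ge0 => i im; have [h _] := fibre_gap_ge j k h2 im.
  by rewrite invr_ge0 subr_ge0 ltW.
have [x0|x0] := leP x 0.
  apply: (@le_trans _ _ 0); last exact: ler01.
  by rewrite mulr_le0_ge0// addr_ge0// ltW.
have tau_le : tau <= (\sum_(i < 8) fibre_gap i) / ln 10.
  have -> : (\sum_(i < 8) fibre_gap i) / ln 10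
      = \sum_(i < 9 | i != ord_max) fibre_gap i / ln 10.
    rewrite mulr_suml [RHS]big_mkcond/= [RHS]big_ord_recr/= addr0.
    apply: eq_bigr => i _; rewrite ifT// -val_eqE/= neq_ltn; apply/orP; left.
    exact: ltn_ord.
  by apply: ler_sum => i im; have [] := fibre_gap_ge j k h2 im.
have xle : x <= ln 10 * ((10 * j + k)%N%:R - (79 + 51 / 1000)).
  have := inv_benford_le (ord_max, j, k).
  rewrite /x /delta /dig1 /dig2 /dig3/= -addnA natrD.
  have -> : (100 * 9)%N%:R = 900 :> R by [].
  lra.
suff : ln 10 * ((10 * j + k)%N%:R - (79 + 51 / 1000))
    * (marg23 p j k + (\sum_(i < 8) fibre_gap i) / ln 10) <= 1.
  apply: le_trans; apply: ler_pM; [exact: ltW| |exact: xle|].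
    by apply: addr_ge0; [exact: ltW|exact: tau0].
  by rewrite lerD2l; exact: tau_le.
have cancel (a b : R) : ln 10 * a * (b / ln 10) = a * b by field; rewrite gt_eqF.
rewrite marg23_benford -mulrDl cancel.
(* The last diagonal entry is at most [ln 10 * (900 + 10 j + k + 1/2)], which can exceed [L] only if
   [10 j + k > 79.051]. *)
have m80 : (80 <= 10 * j + k)%N.
  rewrite leqNgt; apply/negP => hlt; move: x0; apply/negP; rewrite -leNgt.
  apply: (le_trans xle); rewrite (pmulr_rle0 _ l10) subr_le0.
  by apply: (@le_trans _ _ 79); [rewrite (ler_nat _ _ 79) -ltnS|lra].
have m99 := two_digits_le j k.
have gap0 : 0 <= \sum_(i < 8) fibre_gap i.
  by rewrite !big_ord_recl big_ord0/= /fibre_gap/=; lra.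
have sum0 : 0 <= \sum_(i < 9) lnS (100 * i.+1 + (10 * j + k)) + \sum_(i < 8) fibre_gap i.
  by rewrite addr_ge0// sumr_ge0// => i _; rewrite ltW// lnS_gt0// addn_gt0.
have [m98|m98] := leqP (10 * j + k) 98; last first.
  have e99 : (10 * j + k = 99)%N by apply/eqP; rewrite eqn_leq m99 m98.
  move: sum0; rewrite e99 => sum0.
  by apply: le_trans (ler_wpM2r sum0 _) fibre_num_99; lra.
apply: le_trans _ fibre_num_80; apply: ler_pM; last 2 first.
- by rewrite lerBlDr; apply: (@le_trans _ _ 98); [rewrite (ler_nat _ _ 98)|lra].
- by rewrite lerD2r; apply: ler_sum => i _; apply: lnS_anti;
     rewrite ?addn_gt0// leq_add2l.
- by rewrite subr_ge0; apply: (@le_trans _ _ 80); [lra|rewrite (ler_nat _ 80)].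
- exact: sum0.
Qed.

Lemma hessian_benford_form_le (v : vec R) :
  `|dotv v (mulmv (hessian cond_mutual_info p) v)| <= 3254 * norm2 v ^+ 2.
Proof.
apply: hessian_form_le.
- exact: benford_gt0.
- exact: marg23_benford_inv_le.
- by have := @ln2_gt0 R; lra.
- by move=> w j k; apply: fibre_le; exact: kappa_ge.
Qed.

Lemma C_H_le : C_H R <= 1627.
Proof.
have := @opnorm_tangent_le R _ 3254 (hessian_cmi_sym benford_gt0) _
  hessian_benford_form_le.
by rewrite /C_H => /(_ ltac:(lra)); lra.
Qed.

End HessianNorm.

(** * Lower bound for the Hessian norm *)

Section HessianLower.
Context {R : realType}.
Local Notation p := (benford R).

Lemma pushvB (U : finType) (f : triple -> U) (v w : vec R) u :
  pushv f (fun t => v t - w t) u = pushv f v u - pushv f w u.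
Proof. by rewrite /pushv sumrB. Qed.

Lemma pushv_basis (U : finType) (f : triple -> U) a u :
  pushv f (basis_vec R a) u = (f a == u)%:R.
Proof.
have := @pushv_shift R U f (fun=> 0) a 1 u; rewrite mul1r.
rewrite [pushv _ (fun=> 0) _]big1 ?add0r// => <-.
by apply: eq_bigr => t _; rewrite add0r mul1r.
Qed.

Lemma inv_benford_ge t (c : R) : c * lnS (delta t) <= 1 -> ln 10 * c <= 1 / p t.
Proof.
move=> h; rewrite benfordE div1r invf_div (ler_pM2l ln10_gt0) -[leRHS]div1r.
by rewrite ler_pdivlMr// lnS_gt0// delta_gt0.
Qed.

Let opnorm_num (l l10 x9 x8 y9 y8 O : R) : 0 < l -> 485 * l <= 146 * l10 ->
  l10 * (999 + 49 / 100) <= x9 -> l10 * (998 + 49 / 100) <= x8 ->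
  y9 <= l10 * (52 - 18 / 100) -> y8 <= l10 * (52 - 18 / 100) ->
  (x9 - y9) / l - (- x8 - - y8) / l <= O * 2 -> 1573 <= 1 / 2 * O.
Proof.
move=> l0 hl h9 h8 g9 g8; rewrite -mulrBl (ler_pdivrMr _ _ l0) => hO.
have : 3146 * l <= O * l by lra.
by rewrite (ler_pM2r l0); lra.
Qed.

Let a9 : triple := (ord_max, ord_max, ord_max).
Let a8 : triple := (ord_max, ord_max, Ordinal (isT : (8 < 10)%N)).

Lemma C_H_ge : 1573 <= C_H R.
Proof.
have l10 := @ln10_gt0 R; have l2 := @ln2_gt0 R.
(* The two least likely cells. They share their first two digits, so the (12)- and (2)-parts of the
   form vanish on [v]. *)
pose v : vec R := fun t => basis_vec R a9 t - basis_vec R a8 t.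
have vT : tangent R v.
  rewrite /tangent/= /v sumrB /basis_vec.
  by rewrite (bigD1 a9)//= big1 ?addr0 => [|t /negbTE -> //];
     rewrite (bigD1 a8)//= big1 ?addr0 ?eqxx ?subrr => [|t /negbTE -> //].
have vn : norm2 v ^+ 2 = 2.
  rewrite sqr_norm2 (bigD1 a9)//= (bigD1 a8)//= big1 => [|t /andP[t9 t8]].
    by rewrite /v /basis_vec !eqxx/= subr0 sub0r sqrrN !expr1n addr0.
  by rewrite /v /basis_vec (negbTE t9) (negbTE t8) subrr expr0n.
have := @opnorm_tangent_ge R _ 3254 (hessian_cmi_sym benford_gt0) _
  hessian_benford_form_le v vT.
move=> /(_ ltac:(lra)); rewrite vn.
have dotE w : dotv v w = w a9 - w a8.
  rewrite /dotv (bigD1 a9)//= (bigD1 a8)//= big1 => [|t /andP[t9 t8]].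
    by rewrite /v /basis_vec !eqxx/= subr0 sub0r mul1r mulN1r addr0.
  by rewrite /v /basis_vec (negbTE t9) (negbTE t8) subrr mul0r.
rewrite dotE !(mulmv_hessian benford_gt0) /alt4 !pushvB !pushv_basis.
rewrite !pushv_id !eqxx/= !subrr !mul0r !subr0 !addr0 sub0r.
rewrite -[pushv pi23 _ _]marg23E -[pushv pi23 _ (pi23 a8)]marg23E.
have m9 : 0 < marg23 p ord_max ord_max.
  by rewrite marg23E (pushv_gt0 pi23 a9 benford_gt0).
have m8 : 0 < marg23 p ord_max (Ordinal (isT : (8 < 10)%N)).
  by rewrite marg23E (pushv_gt0 pi23 a8 benford_gt0).
have := marg23_benford_ge (R := R) ord_max ord_max.
have := marg23_benford_ge (R := R) ord_max (Ordinal (isT : (8 < 10)%N)).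
have -> : 193 / 10 ^+ 4 = 193 / 100 / 100 :> R by field.
(* [52 - 18 / 100 = 51.82] lies just above [1 / 0.0193]. *)
have inv_le (x : R) : 0 < x -> 193 / 100 / 100 <= x * ln 10 ->
    1 / x <= ln 10 * (52 - 18 / 100).
  by move=> x0 hx; rewrite ler_pdivrMr// mulrAC; lra.
move=> /(inv_le _ m8) h8 /(inv_le _ m9) h9.
have i9 : ln 10 * (999 + 49 / 100) <= 1 / p a9.
  have d : delta a9 = 999%N by [].
  apply: (@inv_benford_ge a9 (999 + 49 / 100)); rewrite d.
  by have /andP[_] := @lnS_bounds R 999 1999 1000 isT erefl erefl; lra.
have i8 : ln 10 * (998 + 49 / 100) <= 1 / p a8.
  have d : delta a8 = 998%N by [].
  apply: (@inv_benford_ge a8 (998 + 49 / 100)); rewrite d.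
  by have /andP[_] := @lnS_bounds R 998 1997 999 isT erefl erefl; lra.
have := @ln2_le_ln10 R.
rewrite !mulNr => h hO.
exact: (opnorm_num l2 h i9 i8 h9 h8 hO).
Qed.
End HessianLower.

(** * Relative entropy, cell by cell *)

Section Divergence.
Context {R : realType}.
Implicit Types p q u : R.

(** The Bregman divergence of [x ln x]: with [- q + p] each single cell is nonnegative. *)
Definition kl q p : R := q * (ln q - ln p) - q + p.

Lemma kl_ge0 q p : 0 < q -> 0 < p -> 0 <= kl q p.
Proof.
move=> q0 p0; have : ln (1 + (p / q - 1)) <= p / q - 1.
  by apply: le_ln1Dx; have := divr_gt0 p0 q0; lra.
rewrite addrC subrK ln_div ?posrE// => h.
have := ler_wpM2l (ltW q0) h; rewrite /kl.
have -> : q * (p / q - 1) = p - q by field; rewrite gt_eqF.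
lra.
Qed.

(** From [ln y <= y - 1]. This is twice the second-order term, which is affordable for the
    (23)-marginals. *)
Lemma kl_le_sqr q p : 0 < q -> 0 < p -> kl q p <= (q - p) ^+ 2 / p.
Proof.
move=> q0 p0; have : ln (1 + (q / p - 1)) <= q / p - 1.
  by apply: le_ln1Dx; have := divr_gt0 q0 p0; lra.
rewrite addrC subrK ln_div ?posrE// => h.
have := ler_wpM2l (ltW q0) h; rewrite /kl.
have -> : (q - p) ^+ 2 / p = q * (q / p - 1) - q + p by field; rewrite gt_eqF.
lra.
Qed.

(** For [q = p (1 + x)], [ln1D_pade] gives the coefficient [(3 + x) / (6 + 4 x)], which decreases in
    [x] and is evaluated at the worst point [x = - u / 2]. The range of [u] goes beyond 1 because
    [slackU 999 = 1999 / 1998]. *)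
Lemma kl_le_pade q p u : 0 < q -> 0 < p -> 0 <= u -> u < 3 / 2 ->
  - u / 2 * p <= q - p ->
  kl q p <= (6 - u) / (4 * (3 - u)) * ((q - p) ^+ 2 / p).
Proof.
move=> q0 p0 u0 u1 hu; pose x := (q - p) / p.
have qE : q = p * (1 + x) by rewrite /x; field; rewrite gt_eqF.
have x1 : -1 < x.
  by have := q0; rewrite qE pmulr_rgt0//; lra.
have xu : - u / 2 <= x by rewrite /x ler_pdivlMr.
have := ln1D_pade x1; set P := _ / _ => hP.
have -> : kl q p = p * ((1 + x) * ln (1 + x) - x).
  by rewrite /kl qE lnM ?posrE//; [ring|lra].
have -> : (q - p) ^+ 2 / p = p * x ^+ 2 by rewrite qE; field; rewrite gt_eqF.
have -> : (6 - u) / (4 * (3 - u)) * (p * x ^+ 2)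
    = p * ((6 - u) / (4 * (3 - u)) * x ^+ 2) by ring.
rewrite (ler_pM2l p0).
have y0 : 0 <= 1 + x by lra.
have := ler_wpM2l y0 hP; have z0 : 0 < 6 + 4 * x by lra.
have -> : (1 + x) * P = x + (3 + x) / (6 + 4 * x) * x ^+ 2.
  by rewrite /P; field; rewrite gt_eqF//; lra.
have : (3 + x) / (6 + 4 * x) <= (6 - u) / (4 * (3 - u)).
  rewrite ler_pdivrMr// mulrAC ler_pdivlMr; last lra.
  by have h : 0 <= 2 * x + u; lra.
by move=> /(ler_wpM2r (sqr_ge0 x)); lra.
Qed.

(** The log-sum inequality. With [c = A / B], nonnegativity of [kl (a i) (c * b i)] bounds
    [kl (a i) (b i)] below by a linear expression, and these add up to the left-hand side. *)
Lemma kl_sum_le (I : finType) (P : pred I) (a b : I -> R) :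
  (forall i, P i -> 0 < a i) -> (forall i, P i -> 0 < b i) ->
  0 < \sum_(i | P i) a i -> 0 < \sum_(i | P i) b i ->
  kl (\sum_(i | P i) a i) (\sum_(i | P i) b i) <= \sum_(i | P i) kl (a i) (b i).
Proof.
move=> a0 b0; set A := \sum_(i | _) a i; set B := \sum_(i | _) b i => A0 B0.
pose c := A / B; have c0 : 0 < c by rewrite divr_gt0.
apply: (@le_trans _ _ (\sum_(i | P i) (ln c * a i + (1 - c) * b i))).
  rewrite big_split/= -!mulr_sumr -/A -/B /kl /c ln_div ?posrE//.
  rewrite le_eqVlt; apply/orP; left; apply/eqP; field; rewrite gt_eqF//.
apply: ler_sum => i Pi.
have := kl_ge0 (a0 i Pi) (mulr_gt0 c0 (b0 i Pi)).
by rewrite /kl lnM ?posrE ?b0//; lra.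
Qed.

End Divergence.

(** * Exact expansion of conditional mutual information *)

Section CmiDecomposition.
Context {R : realType}.
Variables Q p : vec R.
Hypotheses (Q0 : forall t, 0 < Q t) (p0 : forall t, 0 < p t).

Definition klf (U : finType) (f : triple -> U) : R :=
  \sum_u kl (pushv f Q u) (pushv f p u).

Lemma klfE (U : finType) (f : triple -> U) : klf f
  = \sum_t Q t * (ln (pushv f Q (f t)) - ln (pushv f p (f t)))
    - \sum_t Q t + \sum_t p t.
Proof.
rewrite /klf !big_split/= sumrN (sum_pushv f Q) (sum_pushv f p).
by rewrite -(sum_pushvM f Q (fun u => ln (pushv f Q u) - ln (pushv f p u))).
Qed.

(** By Euler's identity the remainder is [Q . (grad F Q - grad F p)], an alternating sum of relative
    entropies; the total masses in the four [klf] cancel. *)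
Lemma cmi_decomp : cond_mutual_info Q - cond_mutual_info p
  = \sum_t (Q t - p t) * grad_cmi p t + alt4 (fun U f => klf f) / ln 2.
Proof.
rewrite !cmi_grad// /alt4 !klfE.
set A := \sum_t Q t; set B := \sum_t p t.
have -> : \sum_t (Q t - p t) * grad_cmi p t
    = \sum_t Q t * grad_cmi p t - \sum_t p t * grad_cmi p t.
  by rewrite -sumrB; apply: eq_bigr => t _; rewrite mulrBl.
suff -> : \sum_t Q t * grad_cmi Q t = \sum_t Q t * grad_cmi p t
  + (\sum_t Q t * (ln (pushv id Q t) - ln (pushv id p t))
     + \sum_t Q t * (ln (pushv pi2 Q (pi2 t)) - ln (pushv pi2 p (pi2 t)))
     - \sum_t Q t * (ln (pushv pi12 Q (pi12 t)) - ln (pushv pi12 p (pi12 t)))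
     - \sum_t Q t * (ln (pushv pi23 Q (pi23 t)) - ln (pushv pi23 p (pi23 t))))
    / ln 2 by lra.
rewrite -big_split/= -!sumrB mulr_suml -big_split/=.
by apply: eq_bigr => t _; rewrite /grad_cmi /alt4; ring.
Qed.

Lemma pushv_pi23_gt0 (v : vec R) u : (forall t, 0 < v t) -> 0 < pushv pi23 v u.
Proof. by case: u => j k v0; exact: (pushv_gt0 pi23 (ord0, j, k)). Qed.

Lemma pushv_pi2_gt0 (v : vec R) u : (forall t, 0 < v t) -> 0 < pushv pi2 v u.
Proof. by move=> v0; exact: (pushv_gt0 pi2 (ord0, u, ord0)). Qed.

Lemma klf_pi2_le : klf pi2 <= klf pi12.
Proof.
have -> : klf pi12 = \sum_j \sum_(i : 'I_9)
    kl (pushv pi12 Q (i, j)) (pushv pi12 p (i, j)).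
  by rewrite exchange_big/= pair_bigA/=; apply: eq_bigr => -[i j].
apply: ler_sum => j _; rewrite !pushv_pi2.
by apply: kl_sum_le => [i _|i _||]; rewrite -?pushv_pi2;
  first [exact: pushv_pi12_gt0|exact: pushv_pi2_gt0].
Qed.

Lemma klf_pi12_le : klf pi12 <= klf id.
Proof.
rewrite {2}/klf (partition_big pi12 xpredT)//=; apply: ler_sum => u _.
have := @kl_sum_le R _ (fun t => pi12 t == u) Q p (fun t _ => Q0 t) (fun t _ => p0 t)
  (pushv_pi12_gt0 u Q0) (pushv_pi12_gt0 u p0).
by under [X in _ -> is_true (_ <= X)]eq_bigr do rewrite !pushv_id.
Qed.

Lemma klf_pi2_ge0 : 0 <= klf pi2.
Proof. by apply: sumr_ge0 => u _; rewrite kl_ge0 ?pushv_pi2_gt0. Qed.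

Lemma klf_pi23_ge0 : 0 <= klf pi23.
Proof. by apply: sumr_ge0 => u _; rewrite kl_ge0 ?pushv_pi23_gt0. Qed.

Lemma klf_pi23_le : klf pi23 <=
  chi2 p pi23 (fun t => Q t - p t) (fun t => Q t - p t).
Proof.
apply: ler_sum => u _; rewrite mulrA -expr2 /pushv sumrB.
exact: (kl_le_sqr (pushv_pi23_gt0 u Q0) (pushv_pi23_gt0 u p0)).
Qed.

Lemma klf_id : klf id = \sum_t kl (Q t) (p t).
Proof. by apply: eq_bigr => t _; rewrite !pushv_id. Qed.

Lemma alt4_klf_le : alt4 (fun U f => klf f) <= \sum_t kl (Q t) (p t).
Proof.
rewrite -klf_id /alt4.
by have := klf_pi2_le; have := klf_pi23_ge0; lra.
Qed.

Lemma alt4_klf_ge : - klf pi23 <= alt4 (fun U f => klf f).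
Proof. by rewrite /alt4; have := klf_pi12_le; have := klf_pi2_ge0; lra. Qed.

End CmiDecomposition.

(** * Digits and total mass of the empirical law *)

Section Digits.
Context {R : realType}.

Lemma floor10_bounds (x : R) :
  0 <= Num.floor (10 * x) - 10 * Num.floor x <= 9.
Proof.
have h1 := Num.Theory.floor_le x; have h2 := Num.Theory.floorD1_gt x.
have h3 := Num.Theory.floor_le (10 * x); have h4 := Num.Theory.floorD1_gt (10 * x).
move: h2 h4; rewrite !rmorphD/= => h2 h4.
have a1 : 10 * Num.floor x < Num.floor (10 * x) + 1.
  by rewrite -(ltr_int R) rmorphM rmorphD/=; lra.
have a2 : Num.floor (10 * x) < 10 * Num.floor x + 10.
  by rewrite -(ltr_int R) !rmorphD rmorphM/=; lra.
lia.
Qed.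

Lemma digitE k (x : R) : digit k x =
  Num.floor (10 * (10 ^ (k%:Z - 2) * significand x))
  - 10 * Num.floor (10 ^ (k%:Z - 2) * significand x).
Proof.
rewrite /digit; congr (Num.floor _ - _).
rewrite mulrA -{2}(expr1z 10) -expfzDr ?pnatr_eq0//; congr (_ ^ _ * _).
by lia.
Qed.

Lemma digit_bounds k (x : R) : 0 <= digit k x <= 9.
Proof. by rewrite digitE; exact: floor10_bounds. Qed.

Lemma digit1_ge1 (x : R) : 0 < x -> 1 <= digit 1 x.
Proof.
move=> /significandP[/andP[m1 m10] _]; rewrite /digit expr0z mul1r.
have -> : Num.floor (10 ^ (1%:Z - 2) * significand x) = 0.
  apply/eqP; rewrite floor_eq add0r.
  have -> : (10 : R) ^ (1%:Z - 2) = 10^-1 by [].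
  by apply/andP; split; rewrite mulrC ?divr_ge0 ?ltr_pdivrMr//; lra.
by rewrite mulr0 subr0 floor_ge_int.
Qed.

Lemma sum_digit_indicator (x : R) : 0 < x ->
  (\sum_t [&& digit 1 x == (dig1 t)%:Z, digit 2 x == (dig2 t)%:Z
           & digit 3 x == (dig3 t)%:Z])%N = 1%N.
Proof.
move=> x0; have d1 := digit1_ge1 x0; have /andP[_ d1'] := digit_bounds 1 x.
have /andP[d2 d2'] := digit_bounds 2 x; have /andP[d3 d3'] := digit_bounds 3 x.
move: d1 d1' d2 d2' d3 d3'.
move: (digit 1 x) (digit 2 x) (digit 3 x) => a b c a1 a9 b0 b9 c0 c9.
have [i ai] : exists i : 'I_9, a = i.+1%:Z.
  have h : (`|a|%N.-1 < 9)%N by lia.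
  by exists (Ordinal h) => /=; lia.
have [j bj] : exists j : 'I_10, b = j%:Z.
  have h : (`|b|%N < 10)%N by lia.
  by exists (Ordinal h) => /=; lia.
have [k ck] : exists k : 'I_10, c = k%:Z.
  have h : (`|c|%N < 10)%N by lia.
  by exists (Ordinal h) => /=; lia.
rewrite ai bj ck (bigD1 (i, j, k))//= !eqxx/= big1 ?addn0// => -[[i' j'] k'].
rewrite !xpair_eqE => h.
apply/eqP; rewrite eqb0; apply: contra h => /and3P[].
rewrite /dig1 /dig2 /dig3/= !eqz_nat eqSS => /eqP e1 /eqP e2 /eqP e3.
by rewrite -!val_eqE/= e1 e2 e3 !eqxx.
Qed.

(** Makes the perturbation tangent, so that the gradient may be replaced by its projection. *)
Lemma sum_empirical (a : nat -> R) N : (forall n, (1 <= n)%N -> 0 < a n) ->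
  (1 <= N)%N -> \sum_t empirical a N t = 1.
Proof.
move=> a0 N1; have N0 : N%:R != 0 :> R by rewrite pnatr_eq0 -lt0n.
rewrite /empirical -mulr_suml -natr_sum.
under eq_bigr do rewrite -sum1_count big_mkcond/=.
rewrite exchange_big/= big_seq (eq_bigr (fun=> 1%N)) => [|n]; last first.
  rewrite mem_iota => /andP[n1 _]; rewrite -[RHS](sum_digit_indicator (a0 n n1)).
  by apply: eq_bigr => t _; case: ifP.
by rewrite -big_seq sum1_size size_iota divff.
Qed.

End Digits.

(** * Interval computation of the gradient *)

Section GradientCheck.
Local Open Scope Z_scope.

(* Fixed-point arithmetic with unit [2^-36]: a pair of integers [(l, h)] encloses
   a real [x] when [l <= 2^36 x <= h]. *)
Definition fxu : Z := 2 ^ 36.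

(* The two bounds of [lnS_bounds]. *)
Definition lnS_lo (n : Z) : Z :=
  let N := 2 * n + 1 in fxu * (6 * (N * N) + 2) / (3 * N * (N * N)).
Definition lnS_hi (n : Z) : Z :=
  let N := 2 * n + 1 in
  fxu * (6 * (N * N) - 4) / (3 * N * (4 * (n * (n + 1)))) + 1.

Fixpoint zsum (n : nat) (f : nat -> Z) : Z :=
  match n with O => 0 | S m => zsum m f + f m end.

Definition quint : Type := Z * Z * Z * Z * Z.
Definition quint_add (x y : quint) : quint :=
  let: (x1, x2, x3, x4, x5) := x in let: (y1, y2, y3, y4, y5) := y in
  (x1 + y1, x2 + y2, x3 + y3, x4 + y4, x5 + y5).

Fixpoint qsum (n : nat) (f : nat -> quint) : quint :=
  match n with
  | O => (0, 0, 0, 0, 0)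
  | S m => quint_add (qsum m f) (f m)
  end.

(* [ln_err] exceeds [2^36 / 10^6], the error of [ln_ratio_approx];
   [mean_err] exceeds the mean of the gradient in the same unit. *)
Definition ln_err : Z := 68720.
Definition mean_err : Z := 1600000.

Definition sqr_lo (l h : Z) : Z :=
  if 0 <=? l then l * l else if h <=? 0 then h * h else 0.
Definition sqr_hi (l h : Z) : Z := Z.max (l * l) (h * h).

(* [slack_num d / slack_den d] is [slack d], and [weight_lo d] a lower bound for
   [2^20 weight d]; see [slack_numE] and [weight_bounds]. *)
Definition slack_num (d : Z) : Z :=
  let N := 2 * d + 1 in
  6834 * 192 * (4 * 1998) * (3 * 1998 - N)
  - 277 * (100 * 100) * (N * (6 * 1998 - N)).
Definition slack_den (d : Z) : Z :=
  100 * 100 * 192 * (4 * 1998) * (3 * 1998 - (2 * d + 1)).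
Definition weight_den (d : Z) : Z := 100 * slack_num d + 28 * slack_den d.
Definition weight_lo (d : Z) : Z := 2 ^ 20 * (100 * slack_num d) / weight_den d.

(** For [2 (a - b) / (a + b)], the stand-in for [ln (a / b)]; it increases in [a] and decreases in
    [b], so opposite ends are paired. *)
Definition ratio_lo (al bh : Z) : Z := 2 * fxu * (al - bh) / (al + bh).
Definition ratio_hi (ah bl : Z) : Z := 2 * fxu * (ah - bl) / (ah + bl) + 1.

(* Summing over the cells: the number of cells where the enclosures are too wide,
   the bounds of the log-ratio, a lower bound of its centred square, and a lower
   bound of the weighted centred square. *)
Definition cell_sums (d l h : Z) : quint :=
  let l1 := l - ln_err in let h1 := h + ln_err in
  let l2 := l1 - mean_err in let h2 := h1 + mean_err in
  let w := weight_lo d in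
  ((if (- fxu <=? 50 * l) && (50 * h <=? fxu) && (0 <? weight_den d)
    then 0 else 1),
   l1, h1, sqr_lo l2 h2,
   (if 0 <=? w then sqr_lo l2 h2 * w else sqr_hi l2 h2 * w)).

Definition cell_lo (s2l s23h a b d : Z) : Z :=
  ratio_lo (lnS_lo d * s2l) (lnS_hi (10 * a + b) * s23h).
Definition cell_hi (s2h s23l a b d : Z) : Z :=
  ratio_hi (lnS_hi d * s2h) (lnS_lo (10 * a + b) * s23l).

Definition dg1 (i : nat) : Z := Z.of_nat i + 1.
Definition cell_delta (i j k : nat) : Z :=
  100 * dg1 i + 10 * Z.of_nat j + Z.of_nat k.

Definition cell (s2l s2h s23l s23h : Z) (i j k : nat) : quint :=
  let d := cell_delta i j k in
  cell_sums d (cell_lo s2l s23h (dg1 i) (Z.of_nat j) d)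
              (cell_hi s2h s23l (dg1 i) (Z.of_nat j) d).

Definition s2_lo j := zsum 9 (fun i => lnS_lo (10 * dg1 i + Z.of_nat j)).
Definition s2_hi j := zsum 9 (fun i => lnS_hi (10 * dg1 i + Z.of_nat j)).
Definition s23_lo j k := zsum 9 (fun i => lnS_lo (cell_delta i j k)).
Definition s23_hi j k := zsum 9 (fun i => lnS_hi (cell_delta i j k)).

(** With the leading digit innermost, each marginal is computed once per [j] or [(j, k)]. *)
Definition grad_total : quint :=
  qsum 10 (fun j =>
    let s2l := s2_lo j in let s2h := s2_hi j in
    qsum 10 (fun k =>
      let s23l := s23_lo j k in let s23h := s23_hi j k in
      qsum 9 (fun i => cell s2l s2h s23l s23h i j k))).

(** [0.03767] is chosen so that its root divided by [ln 2] is still at least [0.28], the [c0] of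
    [secular_bound]; the last test is the positivity required there. *)
Definition grad_check : bool :=
  let: (bad, lo, hi, sq, wsq) := grad_total in
  (bad =? 0) && (- (900 * mean_err) <=? lo) && (hi <=? 900 * mean_err)
  && (fxu * fxu * 3767 <=? sq * (100 * 1000)) && (0 <=? wsq).
End GradientCheck.

Lemma grad_checkT : grad_check.
Proof. by vm_compute. Qed.

(** * Soundness of the interval operations *)

Section Enclosures.
Context {R : realType}.
Implicit Types x y : R.

(* Locked: reducing [zr fxu] would expand [2^36] in unary. *)
Definition unit36 : R := locked (zr fxu).

Lemma unit36E : zr fxu = unit36. Proof. by rewrite /unit36 -lock. Qed.

Definition enc (l h : Z) x : Prop := zr l <= unit36 * x <= zr h.

Lemma unit36_gt0 : 0 < unit36. Proof. by rewrite -unit36E -[0]zr0; exact: zr_lt. Qed.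

Lemma zr_zsum n f : zr (zsum n f) = \sum_(i < n) zr (f i) :> R.
Proof. by elim: n => [|n ih]; rewrite ?big_ord0// big_ord_recr/= zrD ih. Qed.

Lemma enc_sum n (l h : nat -> Z) (x : nat -> R) :
  (forall i, enc (l i) (h i) (x i)) ->
  enc (zsum n l) (zsum n h) (\sum_(i < n) x i).
Proof.
move=> H; rewrite /enc !zr_zsum mulr_sumr.
by apply/andP; split; apply: ler_sum => i _; have /andP[] := H i.
Qed.

Lemma zr_half_odd n : zr (2 * Z.of_nat n + 1)%BZ = 2 * n%:R + 1 :> R.
Proof. by rewrite zrD zrM zr_nat. Qed.

Lemma enc_lnS n : (0 < n)%N ->
  enc (lnS_lo (Z.of_nat n)) (lnS_hi (Z.of_nat n)) (lnS n).
Proof.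
move=> n0; have n0R : 0 < n%:R :> R by rewrite ltr0n.
have N0 : 2 * n%:R + 1 != 0 :> R by rewrite gt_eqF//; lra.
have u0 := unit36_gt0.
have eN := zr_half_odd n.
have e6 : zr 6%BZ = 6 :> R by []. have e2 : zr 2%BZ = 2 :> R by [].
have e3 : zr 3%BZ = 3 :> R by []. have e4 : zr 4%BZ = 4 :> R by [].
rewrite /enc /lnS_lo /lnS_hi; cbv zeta.
have Npos : (0 < 2 * Z.of_nat n + 1)%BZ by lia.
move: eN Npos; generalize (2 * Z.of_nat n + 1)%BZ => N eN Npos.
apply/andP; split.
  apply: (le_trans (zr_div_le _ _)); first nia.
  have -> : zr (fxu * (6 * (N * N) + 2))%BZ / zr (3 * N * (N * N))%BZ
      = unit36 * (2 / (2 * n%:R + 1) * (1 + 1 / (3 * (2 * n%:R + 1) ^+ 2))).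
    by rewrite (zrM fxu) unit36E !zrM zrD !zrM eN e6 e2 e3; field.
  by rewrite ler_pM2l//; exact: lnS_lower.
apply: le_trans (zr_div_ge _ _); last nia.
have -> : zr (fxu * (6 * (N * N) - 4))%BZ
    / zr (3 * N * (4 * (Z.of_nat n * (Z.of_nat n + 1))))%BZ
    = unit36 * (2 / (2 * n%:R + 1) * (1 + 1 / (12 * n%:R * (n%:R + 1)))).
  rewrite (zrM fxu) unit36E !zrM zrB zrD !zrM eN e6 e3 e4 zr_nat zr1.
  by field; rewrite N0 !gt_eqF//=; lra.
by rewrite ler_pM2l//; exact: lnS_upper.
Qed.

Lemma ratio_mono (a b a' b' : R) : 0 < a -> 0 < b -> a <= a' -> b' <= b ->
  0 < a' -> 0 < b' -> (a - b) / (a + b) <= (a' - b') / (a' + b').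
Proof.
move=> a0 b0 aa bb a0' b0'.
rewrite ler_pdivrMr ?addr_gt0// mulrAC ler_pdivlMr ?addr_gt0//.
have : a * b' <= a' * b by apply: ler_pM => //; exact: ltW.
lra.
Qed.

(** Products of two enclosed numbers carry the squared unit; that scale [c] cancels in the
    quotient. *)
Lemma enc_ratio (a b : R) al ah bl bh c :
  0 < c -> 0 < a -> 0 < b -> (0 < al)%BZ -> (0 < bl)%BZ ->
  zr al <= c * a <= zr ah -> zr bl <= c * b <= zr bh ->
  enc (ratio_lo al bh) (ratio_hi ah bl) (2 * ((a - b) / (a + b))).
Proof.
move=> c0 a0 b0 al0 bl0 /andP[a1 a2] /andP[b1 b2].
have u0 := unit36_gt0; have ca := mulr_gt0 c0 a0; have cb := mulr_gt0 c0 b0.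
have ah0 := lt_le_trans ca a2; have bh0 := lt_le_trans cb b2.
have ah0' : (0 < ah)%BZ.
  by apply/Z.lt_nge => h; have := @zr_le R _ _ h; rewrite zr0 leNgt ah0.
have bh0' : (0 < bh)%BZ.
  by apply/Z.lt_nge => h; have := @zr_le R _ _ h; rewrite zr0 leNgt bh0.
have al0R : 0 < zr al :> R := zr_lt al0; have bl0R : 0 < zr bl :> R := zr_lt bl0.
have e2 : zr 2%BZ = 2 :> R by [].
have -> : (a - b) / (a + b) = (c * a - c * b) / (c * a + c * b).
  by field; rewrite !gt_eqF ?addr_gt0.
have E (p q : R) : unit36 * (2 * (p / q)) = 2 * unit36 * p / q by ring.
apply/andP; split.
  apply: (le_trans (zr_div_le _ _)); first exact: Z.add_pos_pos.
  rewrite (zrM (2 * fxu)%BZ) (zrM _ fxu) unit36E zrB zrD e2 E.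
  rewrite -!(mulrA (2 * unit36)) ler_pM2l ?mulr_gt0//.
  exact: ratio_mono.
apply: le_trans (zr_div_ge _ _); last exact: Z.add_pos_pos.
rewrite (zrM (2 * fxu)%BZ) (zrM _ fxu) unit36E zrB zrD e2 E.
rewrite -!(mulrA (2 * unit36)) ler_pM2l ?mulr_gt0//.
exact: ratio_mono.
Qed.

Lemma enc_sqr_lo l h x : enc l h x -> zr (sqr_lo l h) <= (unit36 * x) ^+ 2.
Proof.
move=> /andP[lx xh]; rewrite /sqr_lo; case: Z.leb_spec0 => [l0|_].
  rewrite zrM -expr2 ler_sqr ?nnegrE//; first exact: zr_ge0.
  exact: le_trans (zr_ge0 l0) lx.
case: Z.leb_spec0 => [h0|_]; last by rewrite zr0 sqr_ge0.
have h0R : zr h <= 0 :> R := zr_le h0.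
rewrite zrM -expr2 -sqrrN -[leRHS]sqrrN ler_sqr ?nnegrE ?lerN2// oppr_ge0//.
exact: le_trans xh h0R.
Qed.

Lemma enc_sqr_hi l h x : enc l h x -> (unit36 * x) ^+ 2 <= zr (sqr_hi l h).
Proof.
move=> /andP[lx xh]; rewrite /sqr_hi.
have [x0|x0] := leP 0 (unit36 * x).
  apply: (@le_trans _ _ (zr (h * h)%BZ)); last by apply: zr_le; lia.
  by rewrite zrM -expr2 ler_sqr ?nnegrE// (le_trans x0 xh).
apply: (@le_trans _ _ (zr (l * l)%BZ)); last by apply: zr_le; lia.
rewrite zrM -expr2 -sqrrN -[leRHS]sqrrN ler_sqr ?nnegrE ?lerN2//.
  by rewrite oppr_ge0 ltW.
by rewrite oppr_ge0 (le_trans lx)// ltW.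
Qed.

End Enclosures.

Definition q1 (x : quint) : Z := x.1.1.1.1.
Definition q2 (x : quint) : Z := x.1.1.1.2.
Definition q3 (x : quint) : Z := x.1.1.2.
Definition q4 (x : quint) : Z := x.1.2.
Definition q5 (x : quint) : Z := x.2.

Lemma grad_checkP : [/\ q1 grad_total = 0%BZ,
  (- (900 * mean_err) <= q2 grad_total)%BZ, (q3 grad_total <= 900 * mean_err)%BZ,
  (fxu * fxu * 3767 <= q4 grad_total * (100 * 1000))%BZ
  & (0 <= q5 grad_total)%BZ].
Proof.
have := grad_checkT; rewrite /grad_check /q1 /q2 /q3 /q4 /q5.
case: grad_total => [[[[bad lo] hi] sq] wsq]/=.
move=> /andP[/andP[/andP[/andP[/Z.eqb_spec ? /Z.leb_spec0 ?] /Z.leb_spec0 ?]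
  /Z.leb_spec0 ?] /Z.leb_spec0 ?].
by split.
Qed.

Lemma qsum_proj (phi : quint -> Z) :
  phi (0, 0, 0, 0, 0)%BZ = 0%BZ ->
  (forall x y, phi (quint_add x y) = (phi x + phi y)%BZ) ->
  forall n f, phi (qsum n f) = zsum n (fun i => phi (f i)).
Proof. by move=> phi0 phiD; elim=> //= n ih f; rewrite phiD ih. Qed.

Definition tcell (t : triple) : quint :=
  cell (s2_lo (dig2 t)) (s2_hi (dig2 t)) (s23_lo (dig2 t) (dig3 t))
       (s23_hi (dig2 t) (dig3 t)) (dig1 t).-1 (dig2 t) (dig3 t).

(** * The gradient of the Benford law *)

Section GradientBounds.
Context {R : realType}.
Local Notation p := (benford R).

Lemma zr_grad_total (phi : quint -> Z) :
  phi (0, 0, 0, 0, 0)%BZ = 0%BZ ->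
  (forall x y, phi (quint_add x y) = (phi x + phi y)%BZ) ->
  zr (phi grad_total) = \sum_t zr (phi (tcell t)) :> R.
Proof.
move=> phi0 phiD.
have E n f : zr (phi (qsum n f)) = \sum_(i < n) zr (phi (f i)) :> R.
  by rewrite (qsum_proj phi0 phiD) zr_zsum.
rewrite sum_pi23.
apply: etrans (E _ _) _.
apply: eq_bigr => j _.
apply: etrans (E _ _) _.
apply: eq_bigr => k _.
exact: E.
Qed.

(** The pointwise conditional mutual information, in nats. *)
Definition log_dep (t : triple) : R := alt4 (fun U f => ln (pushv f p (f t))).

Lemma grad_cmi_benford t : grad_cmi p t = log_dep t / ln 2.
Proof. by []. Qed.

Definition S2 (j : nat) : R := \sum_(i < 9) lnS (10 * i.+1 + j).
Definition S23 (j k : nat) : R := \sum_(i < 9) lnS (100 * i.+1 + 10 * j + k).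

Lemma S2_gt0 j : 0 < S2 j.
Proof.
rewrite /S2 big_ord_recl ltr_wpDr// ?lnS_gt0//.
by apply: sumr_ge0 => i _; rewrite ltW// lnS_gt0// addn_gt0.
Qed.

Lemma S23_gt0 j k : 0 < S23 j k.
Proof.
rewrite /S23 big_ord_recl ltr_wpDr// ?lnS_gt0//.
by apply: sumr_ge0 => i _; rewrite ltW// lnS_gt0// !addn_gt0.
Qed.

Lemma pushv_pi12_benford i j : pushv pi12 p (i, j) = lnS (10 * i.+1 + j) / ln 10.
Proof.
rewrite -marg12E /marg12 -lnS_decade ?addn_gt0// mulr_suml.
apply: eq_bigr => k _; rewrite benfordE; congr (lnS _ / _).
by rewrite /delta /dig1 /dig2 /dig3/=; lia.
Qed.

Lemma pushv_pi2_benford j : pushv pi2 p j = S2 j / ln 10.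
Proof.
rewrite pushv_pi2 mulr_suml; apply: eq_bigr => i _.
exact: pushv_pi12_benford.
Qed.

Lemma pushv_pi23_benford j k : pushv pi23 p (j, k) = S23 j k / ln 10.
Proof.
rewrite -marg23E marg23_benford; congr (_ / _); apply: eq_bigr => i _.
by rewrite addnA.
Qed.

Lemma log_depE i j k : let t := (i, j, k) : triple in
  log_dep t = ln ((lnS (delta t) * S2 j) / (lnS (10 * i.+1 + j) * S23 j k)).
Proof.
move=> t; have l10 := @ln10_gt0 R.
have h1 : 0 < lnS (delta t) :> R by rewrite lnS_gt0// delta_gt0.
have h2 := S2_gt0 j; have h3 := S23_gt0 j k.
have h4 : 0 < lnS (10 * i.+1 + j) :> R by rewrite lnS_gt0// addn_gt0.
rewrite /log_dep /alt4 pushv_id benfordE pushv_pi12_benford.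
rewrite pushv_pi2_benford pushv_pi23_benford.
rewrite !ln_div ?posrE ?mulr_gt0// !lnM ?posrE//; ring.
Qed.

Lemma lnS_lo_gt0 n : (0 < n <= 999)%N -> (0 < lnS_lo (Z.of_nat n))%BZ.
Proof.
move=> /andP[n0 n1]; rewrite /lnS_lo; cbv zeta.
have h0 : (0 < Z.of_nat n)%BZ by lia.
have h1 : (Z.of_nat n <= 999)%BZ by lia.
have hu : (10000 <= fxu)%BZ by [].
move: hu; generalize fxu => u hu.
move: h0 h1; generalize (Z.of_nat n) => z h0 h1.
apply: Z.div_str_pos; nia.
Qed.

Lemma zsum_gt0 n f : (0 < n)%N -> (forall i, (i < n)%N -> (0 < f i)%BZ) ->
  (0 < zsum n f)%BZ.
Proof.
case: n => // n _; elim: n => [|n ih] H; first exact: (H 0%N isT).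
apply: (Z.add_pos_pos (zsum n.+1 f) (f n.+1)); last exact: H.
by apply: ih => i ni; apply: H; exact: ltnW.
Qed.

Lemma dg1E i : dg1 i = Z.of_nat i.+1.
Proof. by rewrite /dg1; lia. Qed.

Lemma cell_deltaE i j k : cell_delta i j k = Z.of_nat (100 * i.+1 + 10 * j + k).
Proof. by rewrite /cell_delta dg1E; lia. Qed.

Lemma decade_indexE i j : (10 * dg1 i + Z.of_nat j)%BZ = Z.of_nat (10 * i.+1 + j).
Proof. by rewrite dg1E; lia. Qed.

Lemma enc_S2 j : enc (s2_lo j) (s2_hi j) (S2 j).
Proof.
apply: (@enc_sum R 9 _ _ (fun i => lnS (10 * i.+1 + j))) => i.
by rewrite decade_indexE; apply: enc_lnS; rewrite addn_gt0.
Qed.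

Lemma enc_S23 j k : enc (s23_lo j k) (s23_hi j k) (S23 j k).
Proof.
apply: (@enc_sum R 9 _ _ (fun i => lnS (100 * i.+1 + 10 * j + k))) => i.
by rewrite cell_deltaE; apply: enc_lnS; rewrite !addn_gt0.
Qed.

Lemma s2_lo_gt0 j : (j < 10)%N -> (0 < s2_lo j)%BZ.
Proof.
move=> j10; apply: zsum_gt0 => // i i9; rewrite decade_indexE.
by apply: lnS_lo_gt0; lia.
Qed.

Lemma s23_lo_gt0 j k : (j < 10)%N -> (k < 10)%N -> (0 < s23_lo j k)%BZ.
Proof.
move=> j10 k10; apply: zsum_gt0 => // i i9; rewrite cell_deltaE.
by apply: lnS_lo_gt0; lia.
Qed.

Lemma encM (l h l' h' : Z) (x y : R) : (0 <= l)%BZ -> (0 <= l')%BZ -> 0 <= x -> 0 <= y ->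
  enc l h x -> enc l' h' y ->
  zr (l * l')%BZ <= unit36 * unit36 * (x * y) <= zr (h * h')%BZ.
Proof.
move=> l0 l0' x0 y0 /andP[a b] /andP[c d]; have u0 := ltW (@unit36_gt0 R).
have -> : unit36 * unit36 * (x * y) = unit36 * x * (unit36 * y) by ring.
have z1 : 0 <= zr l :> R := zr_ge0 l0; have z2 : 0 <= zr l' :> R := zr_ge0 l0'.
by rewrite !zrM; apply/andP; split; apply: ler_pM => //; exact: mulr_ge0.
Qed.

End GradientBounds.

(** * Cell weights for the upper bound *)

Section GradientNumerics.
Context {R : realType}.
Local Notation p := (benford R).
Local Notation u := (@unit36 R).

(* [slackU n] bounds [p_min / p_t] and [slack n] is a lower bound for
   [p_min (C_H - K_t)], with [K_t] the quadratic coefficient of cell [t]: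
   [0.6834 <= 1573 p_min] and [277 / 192 >= 1 / ln 2]. *)
Definition slackU (n : nat) : R := (2 * n%:R + 1) / 1998.
Definition slack (n : nat) : R := 6834 / (100 * 100)
  - 277 / 192 * (slackU n * (6 - slackU n) / (4 * (3 - slackU n))).
(** The factor [a / (a + c0)] of [secular_bound] at [c0 = 0.28]; negative for the least likely
    cells. *)
Definition weight (n : nat) : R := slack n / (slack n + 28 / 100).

Let numE : [/\ zr 6834%BZ = 6834 :> R, zr 192%BZ = 192 :> R,
  zr 277%BZ = 277 :> R, zr 1998%BZ = 1998 :> R & zr 100%BZ = 100 :> R].
Proof. by split. Qed.

Let numE' : [/\ zr 2%BZ = 2 :> R, zr 3%BZ = 3 :> R,
  zr 4%BZ = 4 :> R, zr 6%BZ = 6 :> R & zr 28%BZ = 28 :> R].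
Proof. by split. Qed.

Lemma slack_denE n : zr (slack_den (Z.of_nat n)) =
  100 * 100 * 192 * (4 * 1998) * (3 * 1998 - (2 * n%:R + 1)) :> R.
Proof.
have [e1 e2 e3 e4 e5] := numE; have [f1 f2 f3 f4 f5] := numE'.
by rewrite /slack_den !zrM zrB zr_half_odd !zrM e2 e4 e5 f2 f3.
Qed.

Lemma slack_den_gt0 n : (n <= 999)%N -> 0 < zr (slack_den (Z.of_nat n)) :> R.
Proof.
move=> n999; have n9 : n%:R <= 999 :> R by rewrite (ler_nat _ n 999).
by rewrite slack_denE; apply: mulr_gt0; lra.
Qed.

Let slack_id (a b e c f x : R) : b != 0 -> c != 0 -> f != 0 -> 3 * c - x != 0 ->
  a * b * (4 * c) * (3 * c - x) - e * (f * f) * (x * (6 * c - x))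
  = (a / (f * f) - e / b * (x / c * (6 - x / c) / (4 * (3 - x / c))))
    * (f * f * b * (4 * c) * (3 * c - x)).
Proof. by move=> b0 c0 f0 x0; field; rewrite b0 c0 f0 x0. Qed.

Lemma slack_numE n : (n <= 999)%N ->
  zr (slack_num (Z.of_nat n)) = slack n * zr (slack_den (Z.of_nat n)) :> R.
Proof.
move=> n999; have n9 : n%:R <= 999 :> R by rewrite (ler_nat _ n 999).
have [e1 e2 e3 e4 e5] := numE; have [f1 f2 f3 f4 f5] := numE'.
rewrite slack_denE /slack_num; cbv zeta.
rewrite zrB !zrM !zrB zr_half_odd !zrM e1 e2 e3 e4 e5 f2 f3 f4.
have x0 : 0 < 3 * 1998 - (2 * n%:R + 1) :> R by lra.
apply: slack_id; last exact: lt0r_neq0 x0.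
- by rewrite pnatr_eq0.
- by rewrite pnatr_eq0.
- by rewrite pnatr_eq0.
Qed.

Lemma weight_denE n : (n <= 999)%N -> zr (weight_den (Z.of_nat n))
  = 100 * zr (slack_den (Z.of_nat n)) * (slack n + 28 / 100) :> R.
Proof.
move=> n999; have [e1 e2 e3 e4 e5] := numE; have [f1 f2 f3 f4 f5] := numE'.
rewrite /weight_den zrD (zrM 100%BZ) (zrM 28%BZ) e5 f5 slack_numE//.
by generalize (@zr R (slack_den (Z.of_nat n))) (slack n) => y s; field.
Qed.

Lemma weight_bounds n : (n <= 999)%N -> (0 < weight_den (Z.of_nat n))%BZ ->
  0 < slack n + 28 / 100 /\ zr (weight_lo (Z.of_nat n)) <= zr (2 ^ 20)%BZ * weight n.
Proof.
move=> n999 wd; have d0 := slack_den_gt0 n999; have := @zr_lt R _ _ wd.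
rewrite zr0 weight_denE// => w0.
have s0 : 0 < slack n + 28 / 100.
  by move: w0; rewrite pmulr_rgt0// mulr_gt0.
split=> //; apply: (le_trans (zr_div_le _ wd)).
rewrite zrM weight_denE//; have [e1 e2 e3 e4 e5] := numE.
rewrite (zrM 100%BZ) e5 slack_numE// /weight.
move: d0 s0 {w0}; generalize (@zr R (slack_den (Z.of_nat n))) (slack n).
generalize (@zr R (2 ^ 20)%BZ) => a d s d0 s0.
rewrite le_eqVlt; apply/orP; left; apply/eqP; field.
by rewrite (lt0r_neq0 d0) andbT; have := lt0r_neq0 s0; apply: contra; lra.
Qed.

End GradientNumerics.

#[local] Opaque grad_total.

(** * From the integer sums to single cells *)

Section GradientCells.
Context {R : realType}.
Local Notation u := (@unit36 R).
Local Notation G := (@log_dep R).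

Definition tcell_lo (t : triple) : Z :=
  cell_lo (s2_lo (dig2 t)) (s23_hi (dig2 t) (dig3 t)) (Z.of_nat (dig1 t))
          (Z.of_nat (dig2 t)) (Z.of_nat (delta t)).
Definition tcell_hi (t : triple) : Z :=
  cell_hi (s2_hi (dig2 t)) (s23_lo (dig2 t) (dig3 t)) (Z.of_nat (dig1 t))
          (Z.of_nat (dig2 t)) (Z.of_nat (delta t)).

Lemma tcellE t : tcell t = cell_sums (Z.of_nat (delta t)) (tcell_lo t) (tcell_hi t).
Proof.
rewrite /tcell /cell cell_deltaE dg1E /tcell_lo /tcell_hi.
by rewrite prednK.
Qed.

Lemma q1_tcell_ge0 t : 0 <= zr (q1 (tcell t)) :> R.
Proof.
apply: zr_ge0; rewrite tcellE /q1; cbn [cell_sums fst snd].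
by case: ifP.
Qed.

Lemma grad_sums : [/\ \sum_t zr (q1 (tcell t)) = 0 :> R,
  zr (- (900 * mean_err))%BZ <= \sum_t zr (q2 (tcell t)) :> R,
  \sum_t zr (q3 (tcell t)) <= zr (900 * mean_err)%BZ :> R,
  zr (fxu * fxu * 3767)%BZ <= (\sum_t zr (q4 (tcell t))) * zr (100 * 1000)%BZ :> R
  & 0 <= \sum_t zr (q5 (tcell t)) :> R].
Proof.
have [h1 h2 h3 h4 h5] := grad_checkP.
have D1 x y : q1 (quint_add x y) = (q1 x + q1 y)%BZ.
  by case: x y => [[[[? ?] ?] ?] ?] [[[[? ?] ?] ?] ?].
have D2 x y : q2 (quint_add x y) = (q2 x + q2 y)%BZ.
  by case: x y => [[[[? ?] ?] ?] ?] [[[[? ?] ?] ?] ?].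
have D3 x y : q3 (quint_add x y) = (q3 x + q3 y)%BZ.
  by case: x y => [[[[? ?] ?] ?] ?] [[[[? ?] ?] ?] ?].
have D4 x y : q4 (quint_add x y) = (q4 x + q4 y)%BZ.
  by case: x y => [[[[? ?] ?] ?] ?] [[[[? ?] ?] ?] ?].
have D5 x y : q5 (quint_add x y) = (q5 x + q5 y)%BZ.
  by case: x y => [[[[? ?] ?] ?] ?] [[[[? ?] ?] ?] ?].
split.
- by rewrite -(zr_grad_total erefl D1); exact: (congr1 zr h1).
- by rewrite -(zr_grad_total erefl D2); exact: zr_le h2.
- by rewrite -(zr_grad_total erefl D3); exact: zr_le h3.
- by rewrite -(zr_grad_total erefl D4) -zrM; exact: zr_le h4.
- by rewrite -(zr_grad_total erefl D5); exact: zr_ge0 h5.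
Qed.

(** The check knows the number of bad cells only in total; as the counts are nonnegative, each is
    zero. *)
Lemma q1_tcell t : q1 (tcell t) = 0%BZ.
Proof.
have [/eqP + _ _ _ _] := grad_sums.
rewrite psumr_eq0 => [|s _]; last exact: q1_tcell_ge0.
move=> /allP/(_ t (mem_index_enum _)) /eqP.
have : q1 (tcell t) = 0%BZ \/ q1 (tcell t) = 1%BZ.
  by rewrite tcellE /q1; cbn [cell_sums fst snd]; case: ifP; [left|right].
by case=> // ->; rewrite zr1 => /eqP; rewrite oner_eq0.
Qed.

Lemma tcell_ok t : [/\ (- fxu <= 50 * tcell_lo t)%BZ, (50 * tcell_hi t <= fxu)%BZ
  & (0 < weight_den (Z.of_nat (delta t)))%BZ].
Proof.
have := q1_tcell t; rewrite tcellE /q1; cbn [cell_sums fst snd].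
case: ifP => // /andP[/andP[/Z.leb_spec0 h1 /Z.leb_spec0 h2] /Z.ltb_spec0 h3] _.
by split.
Qed.

Let small_of_enc (c z l h : R) : 0 < c -> - c <= 50 * l -> 50 * h <= c ->
  l <= c * (2 * z) -> c * (2 * z) <= h -> `|z| <= 1 / 100.
Proof.
move=> c0 h1 h2 h3 h4; rewrite ler_norml.
by apply/andP; split; rewrite -(ler_pM2l c0); lra.
Qed.

Let ratio_of_diff (a b : R) (z := (a - b) / (a + b)) : 0 < a -> 0 < b ->
  a / b = (1 + z) / (1 - z).
Proof.
move=> a0 b0; have ab : a + b != 0 by rewrite gt_eqF// addr_gt0.
have -> : 1 + z = 2 * a / (a + b) by rewrite /z; field.
have -> : 1 - z = 2 * b / (a + b) by rewrite /z; field.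
by field; rewrite ab gt_eqF.
Qed.

Let err_of_approx (c g z l h w e : R) : 0 < c -> c * w <= e ->
  l <= c * (2 * z) -> c * (2 * z) <= h ->
  `|g - 2 * z| <= w -> l - e <= c * g <= h + e.
Proof.
move=> c0 ce h1 h2; rewrite ler_norml => /andP[g1 g2].
have h3 := ler_wpM2l (ltW c0) g1; have h4 := ler_wpM2l (ltW c0) g2.
by apply/andP; split; lra.
Qed.

Lemma enc_log_dep t : enc (q2 (tcell t)) (q3 (tcell t)) (G t).
Proof.
have [ok1 ok2 _] := tcell_ok t; have u0 := @unit36_gt0 R.
rewrite tcellE /q2 /q3; set l := tcell_lo t; set h := tcell_hi t.
have E1 : (cell_sums (Z.of_nat (delta t)) l h).1.1.1.2 = (l - ln_err)%BZ by [].
have E2 : (cell_sums (Z.of_nat (delta t)) l h).1.1.2 = (h + ln_err)%BZ by [].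
rewrite E1 E2 {E1 E2}.
case: t @l @h ok1 ok2 => [[i j] k] l h ok1 ok2.
have d0 := delta_gt0 (i, j, k); have d9 := delta_bounds (i, j, k).
set d := delta (i, j, k) in d0 d9 *.
pose A : R := lnS d * S2 j; pose B : R := lnS (10 * i.+1 + j) * S23 j k.
have b0 : (0 < 10 * i.+1 + j)%N by rewrite addn_gt0.
have A0 : 0 < A by rewrite mulr_gt0 ?lnS_gt0 ?S2_gt0.
have B0 : 0 < B by rewrite mulr_gt0 ?lnS_gt0 ?S23_gt0.
pose z := (A - B) / (A + B).
have lo1 : (0 < lnS_lo (Z.of_nat d))%BZ.
  by apply: lnS_lo_gt0; rewrite d0; case/andP: d9.
have lo2 : (0 < lnS_lo (Z.of_nat (10 * i.+1 + j)))%BZ.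
  apply: lnS_lo_gt0; rewrite b0/=.
  by move: (ltn_ord i) (ltn_ord j); clear; lia.
have lo3 := s2_lo_gt0 (ltn_ord j); have lo4 := s23_lo_gt0 (ltn_ord j) (ltn_ord k).
have bE : (10 * Z.of_nat i.+1 + Z.of_nat j)%BZ = Z.of_nat (10 * i.+1 + j).
  by clear; lia.
have encz : enc l h (2 * z).
  have -> : l = ratio_lo (lnS_lo (Z.of_nat d) * s2_lo j)%BZ
      (lnS_hi (Z.of_nat (10 * i.+1 + j)) * s23_hi j k)%BZ by rewrite -bE.
  have -> : h = ratio_hi (lnS_hi (Z.of_nat d) * s2_hi j)%BZ
      (lnS_lo (Z.of_nat (10 * i.+1 + j)) * s23_lo j k)%BZ by rewrite -bE.
  apply: (@enc_ratio R A B _ _ _ _ (u * u)) => //.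
  - exact: mulr_gt0.
  - exact: Z.mul_pos_pos.
  - exact: Z.mul_pos_pos.
  - apply: encM; [exact: Z.lt_le_incl|exact: Z.lt_le_incl|exact/ltW/lnS_gt0
      |exact/ltW/S2_gt0|exact: enc_lnS|exact: enc_S2].
  - apply: encM; [exact: Z.lt_le_incl|exact: Z.lt_le_incl|exact/ltW/lnS_gt0
      |exact/ltW/S23_gt0|exact: enc_lnS|exact: enc_S23].
have e50 : zr 50%BZ = 50 :> R by [].
have := @zr_le R _ _ ok1; have := @zr_le R _ _ ok2.
rewrite zrN !(zrM 50%BZ) unit36E e50 => k2 k1.
case/andP: encz => z1 z2.
have zs : `|z| <= 1 / 100 := small_of_enc u0 k1 k2 z1 z2.
have GE : G (i, j, k) = ln ((1 + z) / (1 - z)).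
  by rewrite log_depE -/d -/A -/B (ratio_of_diff A0 B0).
have err : u * (1 / 10 ^+ 6) <= zr ln_err.
  rewrite mulrA mulr1 ler_pdivrMr ?exprn_gt0//.
  have <- : zr (10 ^ Z.of_nat 6)%BZ = 10 ^+ 6 :> R by rewrite zrX.
  by rewrite -unit36E -zrM; apply: zr_le; vm_compute.
rewrite /enc zrB zrD; apply: (err_of_approx u0 err z1 z2).
by rewrite GE; exact: ln_ratio_approx.
Qed.

End GradientCells.

(** * The centred gradient and its weighted squares *)

Section CentredGradient.
Context {R : realType}.
Local Notation u := (@unit36 R).
Local Notation G := (@log_dep R).

Lemma card_triple : #|triple|%:R = 900 :> R.
Proof. by rewrite /triple !card_prod !card_ord. Qed.

Definition log_dep_mean : R := (\sum_t G t) / #|triple|%:R.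
Local Notation M := log_dep_mean.

Let mean_bound (c s m : R) : - (900 * m) <= c * s -> c * s <= 900 * m ->
  - m <= c * (s / 900) <= m.
Proof.
move=> h1 h2; have -> : c * (s / 900) = c * s / 900 by ring.
by apply/andP; split; [rewrite ler_pdivlMr|rewrite ler_pdivrMr]; lra.
Qed.

Lemma log_dep_mean_bound : - zr mean_err <= u * M <= zr mean_err.
Proof.
have [_ h2 h3 _ _] := @grad_sums R.
have e9 : zr 900%BZ = 900 :> R by [].
move: h2 h3; rewrite zrN (zrM 900%BZ) e9 => h2 h3.
have a1 : \sum_t zr (q2 (tcell t)) <= u * \sum_t G t.
  by rewrite mulr_sumr; apply: ler_sum => t _; have /andP[] := enc_log_dep (R := R) t.
have a2 : u * \sum_t G t <= \sum_t zr (q3 (tcell t)).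
  by rewrite mulr_sumr; apply: ler_sum => t _; have /andP[] := enc_log_dep (R := R) t.
rewrite /M card_triple; apply: mean_bound.
  exact: le_trans h2 a1.
exact: le_trans a2 h3.
Qed.

Let shift_bound (c g m l h e : R) : l <= c * g <= h -> - e <= c * m <= e ->
  l - e <= c * (g - m) <= h + e.
Proof.
by move=> /andP[? ?] /andP[? ?]; rewrite mulrBr; apply/andP; split; lra.
Qed.

Lemma enc_centred t :
  enc (q2 (tcell t) - mean_err)%BZ (q3 (tcell t) + mean_err)%BZ (G t - M).
Proof.
rewrite /enc zrB zrD; apply: shift_bound; last exact: log_dep_mean_bound.
exact: enc_log_dep.
Qed.

Lemma cell_sumsE d l h (l2 := (l - ln_err - mean_err)%BZ)
    (h2 := (h + ln_err + mean_err)%BZ) (x := cell_sums d l h) :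
  [/\ (q2 x - mean_err)%BZ = l2, (q3 x + mean_err)%BZ = h2, q4 x = sqr_lo l2 h2
    & q5 x = if (0 <=? weight_lo d)%BZ then (sqr_lo l2 h2 * weight_lo d)%BZ
             else (sqr_hi l2 h2 * weight_lo d)%BZ].
Proof. by []. Qed.

Lemma q4_tcell_le t : zr (q4 (tcell t)) <= (u * (G t - M)) ^+ 2.
Proof.
have := enc_centred t; rewrite tcellE.
generalize (Z.of_nat (delta t)) (tcell_lo t) (tcell_hi t) => d l h.
have [-> -> -> _] := cell_sumsE d l h; exact: enc_sqr_lo.
Qed.

Lemma q5_tcell_le t :
  zr (q5 (tcell t)) <= (u * (G t - M)) ^+ 2 * (zr (2 ^ 20)%BZ * weight (delta t)).
Proof.
have [_ _ wd] := @tcell_ok R t; have /andP[_ d9] := delta_bounds t.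
have [_ wle] := @weight_bounds R (delta t) d9 wd.
apply: (@le_trans _ _ ((u * (G t - M)) ^+ 2 * zr (weight_lo (Z.of_nat (delta t))))).
  have := enc_centred t; rewrite tcellE.
  move: (Z.of_nat (delta t)) (tcell_lo t) (tcell_hi t) => d l h.
  have [-> -> _ ->] := cell_sumsE d l h; move: (weight_lo d) => w e.
  (* With a negative weight, a lower bound of the product needs the upper bound of the square. *)
  case: Z.leb_spec0 => [w0|/Z.nle_gt w0]; rewrite zrM.
    by apply: ler_wpM2r; [exact: zr_ge0|exact: enc_sqr_lo].
  apply: ler_wnM2r; last exact: enc_sqr_hi.
  by rewrite -[leRHS]zr0; apply: zr_le; exact: Z.lt_le_incl.
by rewrite ler_wpM2l ?sqr_ge0.
Qed.

Let scale_bound (c s x : R) : 0 < c ->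
  c * c * 3767 <= s * (100 * 1000) -> s <= c ^+ 2 * x -> 3767 / (100 * 1000) <= x.
Proof.
move=> c0 h1 h2; have k0 : 0 < 100 * 1000 :> R by lra.
rewrite (ler_pdivrMr _ _ k0) -(ler_pM2l (mulr_gt0 c0 c0)) mulrA -expr2.
have := ler_wpM2r (ltW k0) h2; exact: le_trans.
Qed.

Lemma sum_sqr_centred_ge : 3767 / (100 * 1000) <= \sum_t (G t - M) ^+ 2.
Proof.
have [_ _ _ h4 _] := @grad_sums R.
have e1 : zr 3767%BZ = 3767 :> R by []. have e2 : zr 100%BZ = 100 :> R by [].
have e3 : zr 1000%BZ = 1000 :> R by [].
move: h4; rewrite (zrM (fxu * fxu)%BZ) (zrM fxu) unit36E e1 (zrM 100%BZ) e2 e3 => h4.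
apply: (scale_bound unit36_gt0 h4).
by rewrite mulr_sumr; apply: ler_sum => t _; rewrite -exprMn; exact: q4_tcell_le.
Qed.

Lemma sum_weight_centred_ge0 : 0 <= \sum_t (G t - M) ^+ 2 * weight (delta t).
Proof.
have [_ _ _ _ h5] := @grad_sums R; have u0 := @unit36_gt0 R.
have z0 : 0 < zr (2 ^ 20)%BZ :> R by rewrite -[0]zr0; exact: zr_lt.
rewrite -(pmulr_rge0 _ z0) -(pmulr_rge0 _ (exprn_gt0 2 u0)).
apply: (le_trans h5); rewrite !mulr_sumr; apply: ler_sum => t _.
apply: (le_trans (q5_tcell_le t)).
rewrite exprMn le_eqVlt; apply/orP; left; apply/eqP.
by generalize (@zr R (2 ^ 20)%BZ) => z; ring.
Qed.

Lemma slack_gt t : 0 < slack (delta t) + 28 / 100 :> R.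
Proof.
have [_ _ wd] := @tcell_ok R t; have /andP[_ d9] := delta_bounds t.
by have [] := @weight_bounds R (delta t) d9 wd.
Qed.

End CentredGradient.

(** * Trading the linear term against the quadratic excess *)

Section SecularBound.
Context {R : realType} {T : finType}.

(* Cellwise AM-GM with weights [1 + s a_t], where [s = 2 r / (c pm)]. *)
Lemma secular_bound (g D K a : T -> R) (c c0 C pm r : R) :
  0 < c0 -> c0 <= c -> c ^+ 2 = \sum_t g t ^+ 2 ->
  0 <= r -> r ^+ 2 = \sum_t D t ^+ 2 -> 0 < pm -> r <= pm / 2 ->
  (forall t, 0 < a t + c0) -> (forall t, K t <= C - a t / pm) ->
  0 <= \sum_t g t ^+ 2 * (a t / (a t + c0)) ->
  \sum_t g t * D t + \sum_t K t * D t ^+ 2 <= c * r + C * r ^+ 2.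
Proof.
move=> c00 cc cE r0 rE pm0 rpm a0 Ka ga.
have cp : 0 < c := lt_le_trans c00 cc.
have [rz|rn0] := eqVneq r 0.
  have Dz t : D t = 0.
    move: rE; rewrite rz expr0n/= => /esym/eqP.
    rewrite psumr_eq0 => [|s _]; last exact: sqr_ge0.
    by move=> /allP/(_ t (mem_index_enum _)); rewrite /= sqrf_eq0 => /eqP.
  rewrite rz expr0n !mulr0 addr0 !big1 ?addr0// => t _.
    by rewrite Dz expr0n mulr0.
  by rewrite Dz mulr0.
have rp : 0 < r by rewrite lt_neqAle eq_sym rn0.
(* [tau] balances the AM-GM halves at [c r / 2] each; [s] makes [s a_t / (2 tau)] equal to
   [a_t / pm], which cancels the gap between [K t] and [C]. *)
pose tau := r / c; pose s := 2 * tau / pm.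
have tau0 : 0 < tau by rewrite divr_gt0.
have s0 : 0 < s by rewrite divr_gt0// mulr_gt0.
have sc0 : s * c0 <= 1.
  have -> : s * c0 = 2 * r * c0 / (pm * c).
    by rewrite /s /tau; field; rewrite !gt_eqF.
  rewrite ler_pdivrMr ?mulr_gt0// mul1r.
  have h1 : 2 * r <= pm by lra.
  by apply: ler_pM; [rewrite mulr_ge0|exact: ltW| |].
have w0 t : 0 < 1 + s * a t.
  have : 0 < s * (a t + c0) by rewrite mulr_gt0.
  by rewrite mulrDr; lra.
have amgm t : g t * D t + K t * D t ^+ 2 <=
    tau / 2 * (g t ^+ 2 / (1 + s * a t)) + (1 / (2 * tau) + C) * D t ^+ 2.
  have h : g t * D t <= tau / 2 * (g t ^+ 2 / (1 + s * a t))
      + (1 + s * a t) / (2 * tau) * D t ^+ 2.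
    rewrite -subr_ge0.
    have -> : tau / 2 * (g t ^+ 2 / (1 + s * a t))
        + (1 + s * a t) / (2 * tau) * D t ^+ 2 - g t * D t
        = (tau * g t - (1 + s * a t) * D t) ^+ 2 / (2 * tau * (1 + s * a t)).
      by field; rewrite !gt_eqF.
    by apply: divr_ge0; [exact: sqr_ge0|apply/ltW/mulr_gt0; [rewrite mulr_gt0|]].
  have hK := ler_wpM2r (sqr_ge0 (D t)) (Ka t).
  have e : (1 + s * a t) / (2 * tau) = 1 / (2 * tau) + a t / pm.
    by rewrite /s; field; rewrite !gt_eqF.
  move: h; rewrite e; lra.
rewrite -big_split/=; apply: (le_trans (ler_sum _ (fun t _ => amgm t))).
rewrite big_split/= -!mulr_sumr -rE mulrDl addrA lerD2r.
(* For [s c0 <= 1] one has [1 - 1 / (1 + s a) >= s c0 a / (a + c0)], with equality at [s = 1 / c0]: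
   one positivity check covers all radii [r]. *)
have gw : \sum_t g t ^+ 2 / (1 + s * a t) <= c ^+ 2.
  rewrite cE -subr_ge0 -sumrB.
  apply: (@le_trans _ _ (s * c0 * \sum_t g t ^+ 2 * (a t / (a t + c0)))).
    by rewrite mulr_ge0// mulr_ge0// ltW.
  rewrite mulr_sumr; apply: ler_sum => t _.
  rewrite -subr_ge0.
  have -> : g t ^+ 2 - g t ^+ 2 / (1 + s * a t)
      - s * c0 * (g t ^+ 2 * (a t / (a t + c0)))
      = g t ^+ 2 * (s * (a t) ^+ 2 * (1 - s * c0) / ((1 + s * a t) * (a t + c0))).
    by field; rewrite !gt_eqF.
  rewrite mulr_ge0 ?sqr_ge0// divr_ge0//.
    by rewrite mulr_ge0 ?subr_ge0// mulr_ge0 ?sqr_ge0// ltW.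
  by rewrite mulr_ge0// ltW.
have := ler_wpM2l (ltW (divr_gt0 tau0 (ltr0Sn R 1))) gw.
have -> : tau / 2 * c ^+ 2 = c * r / 2 by rewrite /tau; field; rewrite gt_eqF.
have -> : 1 / (2 * tau) * r ^+ 2 = c * r / 2.
  by rewrite /tau; field; rewrite !gt_eqF.
lra.
Qed.

End SecularBound.

(** * The two-sided estimate *)

Section TaylorBound.
Context {R : realType}.
Local Notation p := (benford R).
Local Notation pm := (p_min R).
Local Notation C := (C_H R).

Definition grad_perp (t : triple) : R := (log_dep t - log_dep_mean) / ln 2.

Lemma grad_perp_normE : grad_perp_norm R = norm2 grad_perp.
Proof.
rewrite /grad_perp_norm orthoproj_tangentP; congr norm2; apply/funext => t.
have gE s : gradient cond_mutual_info p s = log_dep s / ln 2.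
  by rewrite /gradient partial_cmi//; exact: benford_gt0.
have -> : \sum_s gradient cond_mutual_info p s = (\sum_s log_dep s) / ln 2.
  by rewrite mulr_suml; apply: eq_bigr => s _; exact: gE.
by rewrite gE /grad_perp /log_dep_mean [RHS]mulrBl (mulrAC (\sum_s _)).
Qed.

Let sqrt_num (l x y : R) : 0 < l -> l <= 253 / 365 -> 3767 / (100 * 1000) <= x ->
  0 <= y -> y ^+ 2 = x / l ^+ 2 -> 28 / 100 <= y.
Proof.
move=> l0 l1 hx y0 yE; rewrite -ler_sqr; [|by rewrite nnegrE; lra|by rewrite nnegrE].
rewrite yE ler_pdivlMr ?exprn_gt0//; apply: le_trans hx.
have l2 : l ^+ 2 <= (253 / 365) ^+ 2 by rewrite ler_sqr ?nnegrE; [|lra|lra].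
apply: (@le_trans _ _ ((28 / 100) ^+ 2 * (253 / 365) ^+ 2)).
  by rewrite ler_wpM2l ?sqr_ge0.
lra.
Qed.

Lemma grad_perp_norm_ge : 28 / 100 <= grad_perp_norm R.
Proof.
have /andP[_ l1] := @ln2_bounds R.
apply: (sqrt_num ln2_gt0 l1 sum_sqr_centred_ge).
  by rewrite grad_perp_normE norm2_ge0.
rewrite grad_perp_normE sqr_norm2 mulr_suml.
by apply: eq_bigr => t _; rewrite /grad_perp expr_div_n.
Qed.

Lemma p_min_ratio_le t : pm / p t <= slackU (delta t).
Proof.
rewrite p_minE benfordE invf_div mulrA divfK ?gt_eqF ?ln10_gt0//.
have h1 := @lnS_le_inv R 999; have h2 := @inv_lnS_le R _ (delta_gt0 t).
apply: (@le_trans _ _ (1 / 999 * ((delta t)%:R + 1 / 2))).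
  apply: ler_pM; [exact/ltW/lnS_gt0| |exact: h1|exact: h2].
  by rewrite invr_ge0; exact/ltW/lnS_gt0/delta_gt0.
by rewrite /slackU; lra.
Qed.

Lemma slackU_bounds t : 0 < @slackU R (delta t) < 3 / 2.
Proof.
have /andP[_ d9] := delta_bounds t.
have n9 : (delta t)%:R <= 999 :> R by rewrite (ler_nat _ _ 999).
have n0 : 0 <= (delta t)%:R :> R by [].
by rewrite /slackU; apply/andP; split; lra.
Qed.

Let coef (x : R) := (6 - x) / (4 * (3 - x)).

Let K_num (k l x y P c : R) : 0 < P -> 0 <= k -> 192 / 277 <= l -> 0 < l ->
  1573 <= c -> 4345 / 1000 / 1000 / 10 <= P ->
  P / y <= x -> 0 < y ->
  k / l / y <= c - (6834 / (100 * 100) - 277 / 192 * (x * k)) / P.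
Proof.
move=> P0 k0 l1 l0 c1 P1 hx y0; rewrite lerBrDr -(ler_pM2r P0) mulrDl divfK ?gt_eqF//.
have -> : k / l / y * P = k / l * (P / y) by ring.
have il : l^-1 <= 277 / 192.
  have -> : 277 / 192 = (192 / 277)^-1 :> R by rewrite invf_div.
  by rewrite lef_pV2 ?posrE; [|exact: l0|lra].
have x0 : 0 <= P / y by rewrite divr_ge0// ltW.
have a1 : k / l * (P / y) <= 277 / 192 * (x * k).
  have -> : k / l * (P / y) = l^-1 * ((P / y) * k) by ring.
  by apply: ler_pM; [rewrite invr_ge0 ltW|exact: mulr_ge0|exact: il|exact: ler_wpM2r].
have a2 : 6834 / (100 * 100) <= c * P.
  apply: (@le_trans _ _ (1573 * (4345 / 1000 / 1000 / 10))); first lra.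
  by apply: ler_pM; [lra|lra|exact: c1|exact: P1].
by move: a1 a2; lra.
Qed.

Lemma p_min_ge : 4345 / 1000 / 1000 / 10 <= pm.
Proof.
have := @p_min_approx R; rewrite ler_norml => /andP[h _].
have e1 : 435 / 10 ^+ 6 = 435 / 1000 / 1000 :> R by field.
have e2 : 5 / 10 ^+ 7 = 5 / 1000 / 1000 / 10 :> R by field.
by move: h; rewrite e1 e2; lra.
Qed.

Section Perturbation.
Variable Q : vec R.
Let D : vec R := fun t => Q t - p t.
Hypotheses (D0 : \sum_t D t = 0) (Dr : norm2 D < pm / 2).

Lemma norm_coord_le t : `|D t| <= norm2 D.
Proof.
rewrite -ler_sqr ?nnegrE ?norm2_ge0// real_normK ?num_real// sqr_norm2.
by rewrite (bigD1 t)//= lerDl sumr_ge0// => s _; exact: sqr_ge0.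
Qed.

(** The radius [p_min / 2] keeps every cell occupied, so the zero-cell convention of [F] never
    arises. *)
Lemma perturbed_gt0 t : 0 < Q t.
Proof.
have := norm_coord_le t; rewrite ler_norml => /andP[h _].
have := p_min_le (R := R) t; have := @p_min_gt0 R; move: h; rewrite /D.
by have := Dr; lra.
Qed.

Lemma sum_grad_perp : \sum_t D t * grad_cmi p t = \sum_t grad_perp t * D t.
Proof.
have -> : \sum_t grad_perp t * D t
    = \sum_t (D t * grad_cmi p t - log_dep_mean / ln 2 * D t).
  by apply: eq_bigr => t _; rewrite /grad_perp grad_cmi_benford; ring.
by rewrite sumrB -mulr_sumr D0 mulr0 subr0.
Qed.

Lemma grad_perp_ge : - (grad_perp_norm R * norm2 D) <= \sum_t grad_perp t * D t.
Proof.
have := dotv_le grad_perp (fun t => -1 * D t).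
rewrite norm2Z normrN1 mul1r -grad_perp_normE /dotv.
have -> : \sum_t grad_perp t * (-1 * D t) = - \sum_t grad_perp t * D t.
  by rewrite -sumrN; apply: eq_bigr => t _; ring.
lra.
Qed.

Lemma cmi_lower : - (grad_perp_norm R * norm2 D + C * norm2 D ^+ 2)
  <= cond_mutual_info Q - cond_mutual_info p.
Proof.
have l2 := @ln2_gt0 R.
rewrite (cmi_decomp perturbed_gt0 benford_gt0) -/(D _) sum_grad_perp opprD.
apply: lerD; first exact: grad_perp_ge.
rewrite ler_pdivlMr//.
apply: le_trans (alt4_klf_ge perturbed_gt0 benford_gt0).
rewrite mulNr lerN2; apply: (le_trans (klf_pi23_le perturbed_gt0 benford_gt0)).
apply: (le_trans (chi2_pi23_le benford_gt0 marg23_benford_inv_le _)).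
rewrite [leLHS]mulrAC; apply: ler_wpM2r; first exact: ltW.
by apply: ler_wpM2r; [exact: sqr_ge0|exact: C_H_ge].
Qed.

Lemma cmi_upper : cond_mutual_info Q - cond_mutual_info p
  <= grad_perp_norm R * norm2 D + C * norm2 D ^+ 2.
Proof.
have l2 := @ln2_gt0 R; have pm0 := @p_min_gt0 R.
rewrite (cmi_decomp perturbed_gt0 benford_gt0) -/(D _) sum_grad_perp.
pose K t := coef (slackU (delta t)) / ln 2 / p t.
apply: (@le_trans _ _ (\sum_t grad_perp t * D t + \sum_t K t * D t ^+ 2)).
  rewrite lerD2l ler_pdivrMr//.
  apply: (le_trans (alt4_klf_le perturbed_gt0 benford_gt0)).
  rewrite mulr_suml; apply: ler_sum => t _.
  have /andP[U0 U1] := slackU_bounds t.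
  have p0 := benford_gt0 (R := R) t.
  have -> : K t * D t ^+ 2 * ln 2 = coef (slackU (delta t)) * ((Q t - p t) ^+ 2 / p t).
    by rewrite /K /D; field; rewrite !gt_eqF.
  apply: kl_le_pade => //; [exact: perturbed_gt0|exact: ltW|].
  (* [D t > - p_min / 2 >= - slackU * p t / 2], the one-sided bound asked by [kl_le_pade]. *)
  have h := p_min_ratio_le t; move: h; rewrite ler_pdivrMr// => h.
  have := norm_coord_le t; rewrite ler_norml => /andP[h1 _].
  by move: h1 Dr; rewrite /D; lra.
apply: (secular_bound (c0 := 28 / 100) (a := fun t => slack (delta t)) (pm := pm)).
- lra.
- exact: grad_perp_norm_ge.
- by rewrite grad_perp_normE sqr_norm2.
- exact: norm2_ge0.
- exact: sqr_norm2.
- exact: pm0.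
- exact: ltW.
- exact: slack_gt.
- move=> t; have /andP[U0 U1] := slackU_bounds t.
  have /andP[l1 _] := @ln2_bounds R.
  have -> : slack (delta t) = 6834 / (100 * 100)
      - 277 / 192 * (slackU (delta t) * coef (slackU (delta t))) :> R.
    by rewrite /slack /coef; congr (_ - _ * _); rewrite mulrA.
  have k0 : 0 <= coef (slackU (delta t)) by apply: divr_ge0; lra.
  exact: (K_num pm0 k0 l1 l2 C_H_ge p_min_ge (p_min_ratio_le t) (benford_gt0 t)).
have -> : \sum_t grad_perp t ^+ 2 * (slack (delta t) / (slack (delta t) + 28 / 100))
    = (\sum_t (log_dep t - log_dep_mean) ^+ 2 * weight (delta t)) / ln 2 ^+ 2.
  by rewrite mulr_suml; apply: eq_bigr => t _; rewrite /grad_perp expr_div_n mulrAC.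
by apply: divr_ge0; [exact: sum_weight_centred_ge0|exact: sqr_ge0].
Qed.

End Perturbation.
End TaylorBound.

Theorem theorem3p4 (R : realType) (a : nat -> R)
    (a_gt0 : forall n : nat, (1 <= n)%N -> 0 < a n) :
  [/\ `|p_min R - 435 / 10 ^+ 6| <= 5 / 10 ^+ 7,
      C_H R <= 1627
    & forall N : nat, (1 <= N)%N ->
        let Delta : vec R := fun t => empirical a N t - benford R t in
        norm2 Delta < p_min R / 2 ->
        `|cond_mutual_info (empirical a N) - cond_mutual_info (benford R)|
          <= grad_perp_norm R * norm2 Delta + C_H R * norm2 Delta ^+ 2].
Proof.
split; [exact: p_min_approx|exact: C_H_le|move=> N N1 Delta Dr].
have D0 : \sum_t Delta t = 0 by rewrite sumrB sum_empirical// sum_benford subrr.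
rewrite ler_norml; apply/andP; split; first exact: cmi_lower.
exact: cmi_upper.
Qed.
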